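(* Let $\{\mathcal{S}(t)\}_{t\ge0}$ be the generalized Skellam process, let $\{\mathscr{D}_{\eta,\theta}(t)\}_{t\ge0}$ be an independent tempered stable subordinator with stability index $0<\theta<1$ and tempering parameter $\eta>0$, and let $p_{f_2}(n,t)=\Pr\{\mathcal{S}(\mathscr{D}_{\eta,\theta}(t))=n\}$. Then $$\Big(\eta^\theta-\frac{\mathrm{d}}{\mathrm{d}t}\Big)^{1/\theta}p_{f_2}(n,t)=(\eta+\Lambda+\bar\Lambda)\,p_{f_2}(n,t)-\Lambda\,p_{f_2}(n-1,t)-\bar\Lambda\,p_{f_2}(n+1,t),\qquad n\in\mathbb{Z}.$$
   Context: Fix an integer $k\ge1$ and positive rates $\lambda_1,\dots,\lambda_k,\mu_1,\dots,\mu_k$; $\Lambda=\lambda_1+\dots+\lambda_k$, $\bar\Lambda=\mu_1+\dots+\mu_k$. The generalized counting process (GCP) with rates $\lambda_1,\dots,\lambda_k$ is a Lévy process started at $0$ performing jumps of size $j\in\{1,\dots,k\}$ at rate $\lambda_j$. The generalized Skellam process (GSP) is $\mathcal{S}(t)=M_1(t)-M_2(t)$, with $M_1,M_2$ independent GCPs with rates $\lambda_j$ and $\mu_j$, respectively. The paper uses throughout that the state probabilities $p(n,t)=\Pr\{\mathcal{S}(t)=n\}$ satisfy $\frac{\mathrm{d}}{\mathrm{d}t}p(n,t)=\Lambda(p(n-1,t)-p(n,t))-\bar\Lambda(p(n,t)-p(n+1,t))$, $n\in\mathbb{Z}$, with $p(0,0)=1$, $p(n,0)=0$ for $n\ne0$.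 The tempered stable subordinator $\mathscr{D}_{\eta,\theta}$ is the Lévy subordinator with $\mathbb{E}(e^{-s\mathscr{D}_{\eta,\theta}(t)})=e^{-tf_2(s)}$, $f_2(s)=(\eta+s)^\theta-\eta^\theta$, $s>0$. The operator $(\eta^\theta-\frac{\mathrm{d}}{\mathrm{d}t})^{1/\theta}$ is the fractional power of $\eta^\theta-\frac{\mathrm{d}}{\mathrm{d}t}$, i.e. the linear operator acting on exponentials by $(\eta^\theta-\frac{\mathrm{d}}{\mathrm{d}t})^{1/\theta}e^{-ts}=(\eta^\theta+s)^{1/\theta}e^{-ts}$ (principal branch, $\operatorname{Re}s>-\eta^\theta$), extended to superpositions of such exponentials; if $1/\theta$ is an integer it is the ordinary power of the differential operator.
   Formalization: For k≥2 a difference of GCPs contradicts the stated system for p(n,t) (p(2,t) has derivative at least λ_2>0 at 0, the system gives 0), so S is either the GSP with k=1, or, for any k, an integer-valued Lévy process whose state probabilities satisfy that system. *)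

(* Defs.v *)
From HB Require Import structures.
From mathcomp Require Import all_boot all_order all_algebra.
From mathcomp Require Import complex.
From mathcomp Require Import all_classical all_reals all_analysis.
Set Implicit Arguments.
Unset Strict Implicit.
Unset Printing Implicit Defensive.
Import Order.TTheory GRing.Theory Num.Theory.
Import numFieldNormedType.Exports.
Local Open Scope classical_set_scope.
Local Open Scope ring_scope.
Local Open Scope complex_scope.

(* A continuous-time process is a map X : R -> Omega -> R, of which only the
   values X t with 0 <= t are constrained.  Integer-valued processes are viewed
   as real-valued ones through n%:R and n%:~R. *)

Section processes.
Context {R : realType} {d : measure_display} {Omega : measurableType d}.
Variable P : probability Omega R.

Definition prob (A : set Omega) : R := fine (P A).

(* Taking some of the A i to be setT gives the product rule for subfamilies. *)
Definition mutually_independent (n : nat) (X : 'I_n -> Omega -> R) : Prop :=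
  forall A : 'I_n -> set R, (forall i, measurable (A i)) ->
    prob [set w | forall i, X i w \in A i] =
      \prod_(i < n) prob [set w | X i w \in A i].

(* Independence of the sigma-algebras generated by the two processes, expressed
   on the generating pi-systems of finite-dimensional cylinders. *)
Definition independent_processes (X Y : R -> Omega -> R) : Prop :=
  forall (m n : nat) (s : 'I_m -> R) (t : 'I_n -> R)
         (A : 'I_m -> set R) (B : 'I_n -> set R),
    (forall i, 0 <= s i) -> (forall j, 0 <= t j) ->
    (forall i, measurable (A i)) -> (forall j, measurable (B j)) ->
    prob ([set w | forall i, X (s i) w \in A i] `&`
          [set w | forall j, Y (t j) w \in B j]) =
      prob [set w | forall i, X (s i) w \in A i] *
      prob [set w | forall j, Y (t j) w \in B j].

(* Path properties are required of every path, not only of almost every one: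
   this makes events such as [S (D t) = n] measurable although the underlying
   probability space is not assumed complete. *)
Record levy_process (X : R -> Omega -> R) : Prop := {
  levy_measurable : forall t, 0 <= t -> measurable_fun setT (X t) ;
  levy_start : forall w, X 0 w = 0 ;
  levy_indep_increments : forall (n : nat) (t : nat -> R),
    0 <= t 0%N -> (forall i, t i <= t i.+1) ->
    mutually_independent (fun (i : 'I_n) w => X (t i.+1) w - X (t i) w) ;
  levy_stationary_increments : forall (s h : R) (A : set R),
    0 <= s -> 0 <= h -> measurable A ->
    prob [set w | X (s + h) w - X s w \in A] = prob [set w | X h w \in A] ;
  levy_right_continuous : forall w t, 0 <= t ->
    X x w @[x --> t^'+] --> X t w ;
  levy_left_limits : forall w t, 0 < t ->
    exists l : R, X x w @[x --> t^'-] --> l }.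

(* The rate of the jumps of size j + 1 is lam j, for j = 0, ..., k - 1; no jump
   of another size occurs, since P (M h = 0) = 1 - (sum of the rates) h + o(h). *)
Record generalized_counting_process (k : nat) (lam : 'I_k -> R)
    (M : R -> Omega -> nat) : Prop := {
  gcp_levy : levy_process (fun t w => (M t w)%:R) ;
  gcp_jump : forall j : 'I_k,
    (prob [set w | M h w = j.+1] / h) @[h --> 0^'+] --> lam j ;
  gcp_no_jump :
    ((1 - prob [set w | M h w = 0%N]) / h) @[h --> 0^'+]
      --> \sum_(j < k) lam j }.

Definition generalized_skellam_process (k : nat) (lam mu : 'I_k -> R)
    (S : R -> Omega -> int) : Prop :=
  exists M1 M2 : R -> Omega -> nat,
    [/\ generalized_counting_process lam M1,
        generalized_counting_process mu M2,
        independent_processes (fun t w => (M1 t w)%:R)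
                              (fun t w => (M2 t w)%:R) &
        forall t w, 0 <= t -> S t w = (M1 t w)%:Z - (M2 t w)%:Z].

Definition state_probability (S : R -> Omega -> int) (n : int) (t : R) : R :=
  prob [set w | S t w = n].

(* The system of equations for p(n,t) with total rates L (up) and L' (down).
   For k >= 2 the difference of two processes with jumps of sizes 1, ..., k
   does not satisfy it with L and L' the sums of the rates: the derivative of
   p(2,t) at 0 is the rate of jumps of size 2, whereas the system gives 0.
   Requiring both would be contradictory for k >= 2; for k = 1 the system is a
   consequence of [generalized_skellam_process]. *)
Definition state_system (L L' : R) (S : R -> Omega -> int) : Prop :=
  let p := state_probability S in
  (forall n : int, p n 0 = (n == 0)%:R) /\
  (forall (n : int) (t : R), 0 < t ->
     is_derive t 1 (p n)
       (L * (p (n - 1) t - p n t) - L' * (p n t - p (n + 1) t))).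

Definition tempered_stable_subordinator (eta theta : R)
    (D : R -> Omega -> R) : Prop :=
  [/\ levy_process D,
      forall w s t, 0 <= s -> s <= t -> D s w <= D t w &
      forall s t : R, 0 < s -> 0 <= t ->
        ('E_P[fun w => expR (- s * D t w)] =
          (expR (- t * ((eta + s) `^ theta - eta `^ theta)))%:E)%E].

End processes.

Section fractional_power.
Context {R : realType}.

Definition cexp (z : R[i]) : R[i] :=
  (expR (complex.Re z) * cos (complex.Im z)) +i*
  (expR (complex.Re z) * sin (complex.Im z)).

(* Principal branch of z ^ a for 0 < Re z, where arg z = atan (Im z / Re z). *)
Definition principal_pow (z : R[i]) (a : R) : R[i] :=
  let r := Num.sqrt (complex.Re z ^+ 2 + complex.Im z ^+ 2) in
  let phi := atan (complex.Im z / complex.Re z) in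
  (r `^ a * cos (a * phi)) +i* (r `^ a * sin (a * phi)).

Definition cintegrable {d : measure_display} {U : measurableType d}
    (m : {measure set U -> \bar R}) (f : U -> R[i]) : Prop :=
  m.-integrable setT (fun x => (complex.Re (f x))%:E) /\
  m.-integrable setT (fun x => (complex.Im (f x))%:E).

Definition cintegral {d : measure_display} {U : measurableType d}
    (m : {measure set U -> \bar R}) (f : U -> R[i]) : R[i] :=
  (\int[m]_(x in setT) complex.Re (f x))%R +i*
  (\int[m]_(x in setT) complex.Im (f x))%R.

(* [frac_shifted_derivative eta theta f g] is the graph, on functions of t >= 0,
   of the operator (eta^theta - d/dt)^(1/theta): f is a superposition of the
   exponentials exp(-t s(x)), with Re s(x) > -eta^theta and complex weights
   w(x) m(dx), and g is the superposition, with the same weights, of their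
   images (eta^theta + s(x))^(1/theta) exp(-t s(x)). *)
Definition frac_shifted_derivative (eta theta : R) (f g : R -> R[i]) : Prop :=
  exists (d : measure_display) (U : measurableType d)
         (m : {measure set U -> \bar R}) (w s : U -> R[i]),
    [/\ measurable_fun setT (fun x => complex.Re (s x)),
        measurable_fun setT (fun x => complex.Im (s x)),
        forall x, - (eta `^ theta) < complex.Re (s x) &
        forall t : R, 0 <= t ->
          let e := fun x => w x * cexp (- (t%:C * s x)) in
          let e' := fun x =>
            w x * (principal_pow ((eta `^ theta)%:C + s x) theta^-1 *
                   cexp (- (t%:C * s x))) in
          [/\ cintegrable m e, f t = cintegral m e,
              cintegrable m e' & g t = cintegral m e']].

End fractional_power.

(* Main.v *)
(* Let L, L' be the total rates, rho = sqrt (L / L') and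
   s(u) = L + L' - 2 sqrt (L L') cos u >= 0.  Fourier inversion of the
   characteristic function of S t, with the contour moved to the circle of
   radius sqrt (L' / L) on which the exponent becomes real, suggests
     p(n, t) = (rho^n / pi) int_0^pi cos(n u) exp(- t s(u)) du.
   The right-hand side solves the system for p, and solutions growing at most
   exponentially in |n| are unique, so the formula holds.  Subordination by D
   turns exp(- t s) into exp(- t psi) with psi = (eta + s)^theta - eta^theta:
   pf2 is a superposition of exponentials with real rates psi > - eta^theta and
   (eta^theta + psi)^(1/theta) = eta + s.  Finally s(u) cos(n u) is a linear
   combination of cos(n u) and cos((n +- 1) u), which is the right-hand side. *)
Require Import Defs.
From HB Require Import structures.
From mathcomp Require Import all_boot all_order all_algebra.
From mathcomp Require Import complex.
From mathcomp Require Import all_classical all_reals all_analysis.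
From mathcomp Require Import measurable_realfun.
From mathcomp Require Import ring lra zify.
Set Implicit Arguments.
Unset Strict Implicit.
Unset Printing Implicit Defensive.
Import Order.TTheory GRing.Theory Num.Theory.
Import numFieldNormedType.Exports.
Local Open Scope classical_set_scope.
Local Open Scope ring_scope.
Local Open Scope complex_scope.

(** * Uniqueness for the system of state probabilities *)

(** The kernel is only controlled by [rho ^ n], which is unbounded in one direction unless the two
    total rates agree; hence uniqueness is proved in a class weighted by a power c^|n| and not
    merely for bounded solutions. The system is given for t > 0 only, so the initial value is tied
    to it by right continuity at 0, which comes from the paths. The paths also settle the second
    obstacle: putting [D t] into [S] calls for measurability and independence at a random time,
    while independence is given for finitely many fixed times. Integer-valued right-continuous paths
    are locally constant to the right, so approximating [D t] strictly from above by countably many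
    values suffices. Both alternatives of [hS] are reduced to path regularity and the system; for k
    = 1 the system is derived from the jump rates, the delicate point being the left derivative. *)

Lemma expr_absz_le (R : realType) (c : R) (n m : int) :
  1 <= c -> (`|m| <= `|n|.+1)%N -> c ^+ `|m|%N <= c * c ^+ `|n|%N.
Proof. by move=> c1 mn; rewrite -exprS ler_weXn2l. Qed.

Lemma absz_neighbours (n : int) :
  (absz (n - 1)%R <= (absz n).+1)%N /\ (absz (n + 1)%R <= (absz n).+1)%N.
Proof. split; lia. Qed.

Section system_uniqueness.
Context {R : realType}.
Variables (a b c K : R) (h : int -> R -> R).
Hypotheses (a0 : 0 <= a) (b0 : 0 <= b) (c1 : 1 <= c) (K0 : 0 <= K).
Hypothesis h0 : forall n, h n 0 = 0.
Hypothesis h0r : forall n, h n x @[x --> 0^'+] --> h n 0.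
Hypothesis hD : forall n (t : R), 0 < t ->
  is_derive t 1 (h n) (a * (h (n - 1) t - h n t) - b * (h n t - h (n + 1) t)).
Hypothesis hB : forall n (t : R), 0 <= t -> `|h n t| <= K * c ^+ `|n|%N.

(** A bound for the right-hand side of the system as an operator in the weighted norm: its terms
    have coefficients a, a, b, b, and each costs at most a factor c, the diagonal ones because 1 <=
    c. *)
Let C := 2 * (a + b) * c.

(* Picard iteration in the weighted norm sup_n |h n t| / c^|n|, in which each of
   the shifts n - 1 and n + 1 has norm at most c. *)
Lemma system_iterate_le (m : nat) (n : int) (t : R) : 0 <= t ->
  `|h n t| <= K * c ^+ `|n|%N * ((C * t) ^+ m / m`!%:R).
Proof.
elim: m n t => [|m IH] n t t0; first by rewrite expr0 fact0 divr1 mulr1 hB.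
have C0 : 0 <= C by rewrite /C !mulr_ge0// ?addr_ge0// (le_trans ler01).
(* [G] is the bound to be proved at m + 1; its derivative [g] is C times the bound at m, and so
   dominates the derivative of [h n]. *)
pose G (s : R) := K * c ^+ `|n|%N * ((C * s) ^+ m.+1 / m.+1`!%:R).
pose g (s : R) := K * c ^+ `|n|%N * (C * ((C * s) ^+ m / m`!%:R)).
have dG (s : R) : is_derive s 1 G (g s).
  pose k := K * c ^+ `|n|%N * C ^+ m.+1 / m.+1`!%:R.
  have -> : G = k \*: (id ^+ m.+1 : R -> R).
    apply/funext => x; rewrite fctE; change (G x = k * x ^+ m.+1).
    by rewrite /G /k [(C * x) ^+ _]exprMn -!mulrA [_^-1 * _]mulrC.
  apply: (is_derive_eq (is_deriveZ k (is_deriveX m.+1 (is_derive_id s 1)))).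
  change (k * (m.+1%:R * s ^+ m * 1) = g s).
  rewrite /g /k factS natrM exprS [(C * s) ^+ m]exprMn mulr1.
  have : m.+1%:R != 0 :> R by rewrite pnatr_eq0.
  have : m`!%:R != 0 :> R by rewrite pnatr_eq0 -lt0n fact_gt0.
  set u := m.+1%:R; set v := m`!%:R; set y := c ^+ _; set z := C ^+ _.
  set x := s ^+ _ => v0 u0; field.
  by rewrite v0 nat1r.
have gB (s : R) : 0 < s ->
    `|a * (h (n - 1) s - h n s) - b * (h n s - h (n + 1) s)| <= g s.
  move=> s0; have s0' := ltW s0.
  pose w := (C * s) ^+ m / m`!%:R.
  have w0 : 0 <= w.
    by rewrite divr_ge0// exprn_ge0// mulr_ge0.
  have q m' : (`|m'| <= `|n|.+1)%N ->
      `|h m' s| <= c * (K * c ^+ `|n|%N * w).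
    move=> mn; apply: le_trans (IH _ _ s0') _.
    rewrite -/w mulrA (ler_wpM2r w0)// [leRHS]mulrCA ler_wpM2l//.
    exact: expr_absz_le.
  have [n1 n2] := absz_neighbours n.
  have {n1}q1 := q _ n1; have {n2}q2 := q _ n2; have q0 := q n (leqnSn _).
  rewrite /g /C -/w; set Z := K * c ^+ _ * w in q0 q1 q2.
  rewrite (_ : _ * (_ * w) = a * (c * Z + c * Z) + b * (c * Z + c * Z)); last first.
    by rewrite /Z; ring.
  rewrite (le_trans (ler_normB _ _))// lerD// normrM ger0_norm// ler_wpM2l//.
    by rewrite (le_trans (ler_normB _ _))// lerD.
  by rewrite (le_trans (ler_normB _ _))// lerD.
have Gc (s : R) : G x @[x --> s] --> G s.
  by apply/differentiable_continuous/derivable1_diffP; apply: ex_derive.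
(* With e = 1 and e = -1 this gives both halves of the estimate: [G + e * h n] vanishes at 0 and has
   nonnegative derivative by [gB]. *)
have mono (e : R) : `|e| = 1 -> 0 <= G t + e * h n t.
  move=> e1; pose F (s : R) := G s + e * h n s.
  have F0 : F 0 = 0 by rewrite /F /G h0 !mulr0 expr0n /= mul0r !mulr0 addr0.
  have dF (s : R) : 0 < s -> is_derive s 1 F
      (g s + e * (a * (h (n - 1) s - h n s) - b * (h n s - h (n + 1) s))).
    by move=> s0; exact: is_deriveD (dG s) (is_deriveZ e (hD n s0)).
  have := @ger0_derive1_ndecry R F 0 _ _ _ 0 t; rewrite F0; apply; [| | |exact: lexx|exact: t0].
  - by move=> x; rewrite in_itv/= andbT => /dF[].
  - move=> x; rewrite in_itv/= andbT => x0; rewrite derive1E.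
    have -> := @derive_val _ _ _ _ _ _ _ (dF _ x0).
    have : `|e * (a * (h (n - 1) x - h n x) - b * (h n x - h (n + 1) x))| <= g x.
      by rewrite normrM e1 mul1r; exact: gB.
    by rewrite ler_norml -subr_ge0 opprK addrC => /andP[].
  - apply/continuous_within_itvcyP; split.
      move=> x; rewrite in_itv/= andbT => x0.
      by apply/differentiable_continuous/derivable1_diffP; have [] := dF x x0.
    apply: cvgD; first exact: cvg_at_right_filter.
    by apply: cvgM; [exact: cvg_cst|exact: h0r].
rewrite ler_norml -/(G t).
have := mono 1 (normr1 _); have := mono (-1).
rewrite normrN1 => /(_ erefl); rewrite mulN1r mul1r; lra.
Qed.

(** The iterated bound holds for every m, and (C t)^m / m! tends to 0 as the general term of the
    exponential series. *)
Lemma system_null (n : int) (t : R) : 0 <= t -> h n t = 0.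
Proof.
move=> t0; apply/normr0_eq0/eqP; rewrite eq_le normr_ge0 andbT.
have := @is_cvg_series_exp_coeff R (C * t).
move=> /cvg_series_cvg_0 /(cvgM (cvg_cst (K * c ^+ `|n|%N))) /=.
rewrite mulr0 => /(ler_cvg_to (cvg_cst `|h n t|)); apply.
by apply: nearW => m; rewrite /exp_coeff /=; exact: system_iterate_le.
Qed.

End system_uniqueness.

(** * The integral representation of the state probabilities *)

Section bounded_on_0pi.
Context {R : realType}.
Local Notation mu := (@lebesgue_measure R).

Lemma integrable_indic_0pi (g : R -> R) (C : R) : measurable_fun setT g ->
  (forall u, `|g u| <= C) ->
  mu.-integrable setT (EFin \o (fun u => \1_`[0, pi] u * g u)).
Proof.
move=> mg gC; have C0 : 0 <= C := le_trans (normr_ge0 _) (gC 0).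
have mI : measurable (`[0, pi] : set R) by exact: measurable_itv.
apply: (@le_integrable _ _ _ mu setT _ _ (fun u => (C * \1_`[0, pi] u)%:E)) => //.
- apply/measurable_EFinP; exact: measurable_funM.
- move=> u _ /=; rewrite lee_fin normrM mulrC.
  rewrite [leRHS]ger0_norm ?mulr_ge0// (ger0_norm (_ : 0 <= \1_`[0, pi] u))//.
  by rewrite ler_wpM2r.
- under eq_fun do rewrite EFinM.
  by apply: integrableZl => //; exact: integrable_indic_itv.
Qed.

End bounded_on_0pi.

Lemma sin_int_pi (R : realType) (n : int) : sin (n%:~R * pi) = 0 :> R.
Proof.
have h (m : nat) : sin (m%:R * pi) = 0 :> R.
  elim: m => [|m IH]; first by rewrite mul0r sin0.
  by rewrite -natr1 mulrDl mul1r sinDpi IH oppr0.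
by case: n => m; [exact: h|rewrite NegzE intrN mulNr sinN h oppr0].
Qed.

Section skellam_kernel.
Context {R : realType}.
Variables a b : R.
Hypotheses (a0 : 0 < a) (b0 : 0 < b).
Local Notation mu := (@lebesgue_measure R).
Let rho := Num.sqrt (a / b).

Definition skellam_rate (u : R) : R := a + b - 2 * Num.sqrt (a * b) * cos u.

(** The indicator confines the integral to [0, pi] while the domain stays [setT], over which
    [cintegral] integrates. *)
Definition skellam_weight (n : int) (u : R) : R :=
  \1_`[0, pi] u * (rho ^ n / pi * cos (n%:~R * u)).

Definition skellam_kernel (n : int) (t : R) : R :=
  \int[mu]_u (skellam_weight n u * expR (- (t * skellam_rate u))).

Let rho0 : 0 < rho. Proof. by rewrite sqrtr_gt0 divr_gt0. Qed.

(** In this form the extreme values are visible: (sqrt a - sqrt b)^2 at cos u = 1 and (sqrt a + sqrt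
    b)^2 <= 2 (a + b) at cos u = -1. *)
Let rateE u : skellam_rate u = (Num.sqrt a - Num.sqrt b) ^+ 2 +
  2 * (Num.sqrt a * Num.sqrt b) * (1 - cos u).
Proof.
rewrite /skellam_rate (sqrtrM _ (ltW a0)).
by rewrite -{1}(sqr_sqrtr (ltW a0)) -{1}(sqr_sqrtr (ltW b0)); ring.
Qed.

Lemma skellam_rate_ge0 u : 0 <= skellam_rate u.
Proof.
by rewrite rateE addr_ge0 ?sqr_ge0// !mulr_ge0 ?sqrtr_ge0// subr_ge0 cos_le1.
Qed.

Lemma skellam_rate_le u : skellam_rate u <= 2 * (a + b).
Proof.
rewrite rateE -{3}(sqr_sqrtr (ltW a0)) -{3}(sqr_sqrtr (ltW b0)).
have c1 := cos_geN1 u.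
have := sqr_ge0 (Num.sqrt a - Num.sqrt b).
have : 0 <= (Num.sqrt a * Num.sqrt b) * (1 + cos u).
  by rewrite !mulr_ge0 ?sqrtr_ge0//; lra.
nra.
Qed.

Lemma measurable_skellam_rate : measurable_fun setT skellam_rate.
Proof.
apply: measurable_funB => //; apply: measurable_funM => //.
by apply: continuous_measurable_fun; exact: continuous_cos.
Qed.

(** Since sqrt (a b) = b rho = a / rho, the symmetric formula 2 cos u cos(n u) = cos((n - 1) u) +
    cos((n + 1) u) acquires the asymmetric coefficients a and b once the powers of [rho] are
    included. *)
Lemma skellam_weight_rec n u :
  skellam_rate u * skellam_weight n u = (a + b) * skellam_weight n u
    - a * skellam_weight (n - 1) u - b * skellam_weight (n + 1) u.
Proof.
rewrite /skellam_weight /skellam_rate -/rho.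
have sE : Num.sqrt (a * b) = b * rho.
  rewrite /rho sqrtrM ?ltW// sqrtrM ?ltW// sqrtrV ?ltW//.
  by rewrite -{2}(sqr_sqrtr (ltW b0)); field; rewrite sqrtr_eq0 -ltNge.
have aE : a = b * rho ^+ 2.
  by rewrite /rho sqr_sqrtr ?divr_ge0 ?ltW//; field; rewrite gt_eqF.
have r0 : rho != 0 by rewrite gt_eqF.
rewrite !intrD !mulrDl intrN !mulN1r !mul1r cosB cosD.
rewrite expfzDr// expfzDr// expr1z exprN1 sE.
have p0 : pi != 0 :> R by rewrite gt_eqF// pi_gt0.
rewrite {3}aE; move: (pi : R) p0 (\1__ u) => p p0 i; field.
by rewrite r0 p0.
Qed.

Let weight_core n u := rho ^ n / pi * cos (n%:~R * u).

Let weight_core_bound n u : `|weight_core n u| <= rho ^ n / pi.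
Proof.
have c0 : 0 <= rho ^ n / pi by rewrite divr_ge0 ?exprz_ge0 ?pi_ge0 ?(ltW rho0).
by rewrite normrM ger0_norm// ler_piMr// cos_max.
Qed.

Let measurable_weight_core n : measurable_fun setT (weight_core n).
Proof.
apply: measurable_funM => //.
apply: (@measurableT_comp _ _ _ _ _ _ cos) => //.
by apply: continuous_measurable_fun; exact: continuous_cos.
Qed.

Lemma integrable_skellam_weight n (phi : R -> R) (C : R) :
  measurable_fun setT phi -> (forall u, `|phi u| <= C) ->
  mu.-integrable setT (EFin \o (fun u => skellam_weight n u * phi u)).
Proof.
move=> mphi phiC.
have := @integrable_indic_0pi R (fun u => weight_core n u * phi u)
  (rho ^ n / pi * C) (measurable_funM (measurable_weight_core n) mphi).
under [X in integrable _ _ (EFin \o X)]eq_fun do rewrite mulrA.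
apply=> u; rewrite normrM ler_pM//; exact: weight_core_bound.
Qed.

(** A general bounded [phi] lets this serve twice: for the system solved by the kernel, and for the
    right-hand side of the theorem with the subordinated exponential. *)
Lemma Rintegral_skellam_weight_rec n (phi : R -> R) (C : R) :
  measurable_fun setT phi -> (forall u, `|phi u| <= C) ->
  \int[mu]_u (skellam_weight n u * (skellam_rate u * phi u)) =
  (a + b) * (\int[mu]_u (skellam_weight n u * phi u))
  - a * (\int[mu]_u (skellam_weight (n - 1) u * phi u))
  - b * (\int[mu]_u (skellam_weight (n + 1) u * phi u)).
Proof.
move=> mphi phiC; have iw m := @integrable_skellam_weight m phi C mphi phiC.
have iZ m k : mu.-integrable setT
    (EFin \o (fun u => k * (skellam_weight m u * phi u))).
  exact: (integrableZl measurableT k (iw m)).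
rewrite -!RintegralZl// -!RintegralB//; last first.
  exact: (integrableB measurableT (iZ _ _) (iZ _ _)).
apply: eq_Rintegral => u _.
rewrite mulrCA mulrA skellam_weight_rec; ring.
Qed.

Let measurable_exp t : measurable_fun setT (fun u => expR (- (t * skellam_rate u))).
Proof.
apply: measurableT_comp => //; apply: measurableT_comp => //.
by apply: measurable_funM => //; exact: measurable_skellam_rate.
Qed.

Let exp_bound t u : `|expR (- (t * skellam_rate u))| <= expR (`|t| * (2 * (a + b))).
Proof.
rewrite ger0_norm ?expR_ge0// ler_expR (le_trans (ler_norm _))// normrN normrM.
by rewrite ler_wpM2l// ger0_norm ?skellam_rate_ge0 ?skellam_rate_le.
Qed.

(** Differentiation under the integral sign. Boundedness of the rate allows every real t; the case t
    = 0 later supplies the continuity of the kernel at its initial time. *)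
Lemma is_derive_skellam_kernel n (t : R) : is_derive t 1 (skellam_kernel n)
  (a * (skellam_kernel (n - 1) t - skellam_kernel n t)
   - b * (skellam_kernel n t - skellam_kernel (n + 1) t)).
Proof.
pose f (t' u : R) := skellam_weight n u * expR (- (t' * skellam_rate u)).
have df (t' u : R) : is_derive t' 1 (f ^~ u)
    (skellam_weight n u * (skellam_rate u * - expR (- (t' * skellam_rate u)))).
  have d1 : is_derive t' 1 (fun x : R => - (x * skellam_rate u)) (- skellam_rate u).
    have -> : (fun x : R => - (x * skellam_rate u)) = (- skellam_rate u) \*: id.
      by apply/funext => x; rewrite -[RHS]/(- skellam_rate u * x) mulNr mulrC.
    by apply: (is_derive_eq (is_deriveZ _ (is_derive_id t' 1))); exact: mulr1.
  apply: (is_derive_eq (is_deriveZ (skellam_weight n u)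
    (is_derive1_comp (is_derive_expR _) d1))).
  rewrite -[LHS]/(skellam_weight n u * (expR (- (t' * skellam_rate u)) * _)).
  by congr (_ * _); rewrite mulrN mulrN mulrC.
have dfE (t' u : R) : partial1of2 f t' u =
    skellam_weight n u * (skellam_rate u * - expR (- (t' * skellam_rate u))).
  by rewrite partial1of2E; exact: derive_val.
(* Dominating function on ]t - 1, t + 1[: there |x| <= |t| + 1, and the rate is at most 2 (a +
   b). *)
pose G u := `|skellam_weight n u * (2 * (a + b) * expR ((`|t| + 1) * (2 * (a + b))))|.
have It : `]t - 1, t + 1[%classic t by rewrite /= in_itv/= ltrBlDr !ltrDl ltr01.
have G0 u : 0 <= G u by exact: normr_ge0.
have ab0 : 0 <= 2 * (a + b) by rewrite mulr_ge0// addr_ge0// ltW.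
have iG : mu.-integrable setT (EFin \o G).
  apply: (integrable_norm (@integrable_skellam_weight n (fun=> _) _ _ _)) => //.
have intf x : `]t - 1, t + 1[%classic x -> mu.-integrable setT (EFin \o f x).
  by move=> _; exact: (integrable_skellam_weight _ (measurable_exp x) (exp_bound x)).
have derf x u : `]t - 1, t + 1[%classic x -> setT u -> derivable (f ^~ u) x 1.
  by move=> _ _; have [] := df x u.
have GB x u : `]t - 1, t + 1[%classic x -> setT u -> `|partial1of2 f x u| <= G u.
  rewrite /= in_itv/= => /andP[x1 x2] _; rewrite dfE /G !normrM ler_wpM2l//.
  rewrite normrN ler_pM//.
    by rewrite -normrM (ger0_norm ab0) ger0_norm ?skellam_rate_ge0 ?skellam_rate_le.
  rewrite (le_trans (exp_bound _ _))// [leRHS]ger0_norm ?expR_ge0// ler_expR.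
  rewrite ler_wpM2r// ler_norml; have := ler_norm t; have := ler_norm (- t).
  by rewrite normrN; lra.
have d1 := derivable_under_integral measurableT It intf derf G0 iG GB.
have d2 := differentiation_under_integral measurableT It intf derf G0 iG GB.
apply: DeriveDef; first exact: d1.
rewrite -derive1E [LHS]d2.
under eq_Rintegral do rewrite dfE.
have mN : measurable_fun setT (fun u => - expR (- (t * skellam_rate u))).
  by apply: measurableT_comp => //; exact: measurable_exp.
have bN u : `|- expR (- (t * skellam_rate u))| <= expR (`|t| * (2 * (a + b))).
  by rewrite normrN.
rewrite (Rintegral_skellam_weight_rec n mN bN).
have kN m : \int[mu]_u (skellam_weight m u * - expR (- (t * skellam_rate u))) =
    - skellam_kernel m t.
  rewrite -mulN1r -RintegralZl//; last first.
    exact: (integrable_skellam_weight _ (measurable_exp t) (exp_bound t)).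
  by apply: eq_Rintegral => u _; rewrite mulrN mulN1r.
by rewrite !kN; ring.
Qed.

(** Orthogonality of cos(n u) to the constants on [0, pi]: for n != 0 the primitive sin(n u) / n
    vanishes at both ends. *)
Lemma skellam_kernel0 n : skellam_kernel n 0 = (n == 0)%:R.
Proof.
rewrite /skellam_kernel /skellam_weight.
under eq_Rintegral do rewrite mul0r oppr0 expR0 mulr1.
rewrite (_ : (fun u => _) = (weight_core n \_ `[0, pi])); last first.
  apply/funext => u; rewrite patchE indicE; case: ifP => _; first exact: mul1r.
  exact: mul0r.
rewrite -Rintegral_mkcond /weight_core.
have p0 := @pi_gt0 R.
have [->|n0] := eqVneq n 0.
  under eq_Rintegral do rewrite mul0r cos0 mulr1 expr0z.
  rewrite Rintegral_cst//= lebesgue_measure_itv/= lte_fin p0 -EFinD/= subr0.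
  by rewrite divfK// gt_eqF.
rewrite /Rintegral.
pose k := rho ^ n / pi.
have nR : n%:~R != 0 :> R by rewrite intr_eq0.
pose F (u : R) := k / n%:~R * sin (n%:~R * u).
have dF (u : R) : is_derive u 1 F (k * cos (n%:~R * u)).
  have d1 := is_deriveZ (n%:~R : R) (is_derive_id u 1).
  apply: (is_derive_eq (is_deriveZ (k / n%:~R)
    (is_derive1_comp (is_derive_sin _) d1))).
  rewrite -[LHS]/(k / n%:~R * (cos (n%:~R * u) * (n%:~R * 1))).
  by field.
have cF (u : R) : {for u, continuous F}.
  by apply/differentiable_continuous/derivable1_diffP; have [] := dF u.
rewrite (@continuous_FTC2 _ _ F)//.
- by rewrite -EFinB/= /F sin_int_pi !mulr0 sin0 mulr0 subrr.
- apply: continuous_subspaceT => u; apply: cvgM; first exact: cvg_cst.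
  have : continuous (cos \o *%R (n%:~R : R)).
    move=> x; apply: continuous_comp; first exact: mulrl_continuous.
    exact: continuous_cos.
  exact.
- split.
  + by move=> u _; have [] := dF u.
  + by apply: cvg_at_right_filter; exact: cF.
  + by apply: cvg_at_left_filter; exact: cF.
- by move=> u _; rewrite derive1E; exact: derive_val.
Qed.

Lemma skellam_kernel_le n t : 0 <= t -> `|skellam_kernel n t| <= rho ^ n.
Proof.
move=> t0.
have eB u : `|expR (- (t * skellam_rate u))| <= 1.
  by rewrite ger0_norm ?expR_ge0// -expR0 ler_expR oppr_le0 mulr_ge0 ?skellam_rate_ge0.
apply: (le_trans (le_normr_Rintegral measurableT
  (integrable_skellam_weight _ (measurable_exp t) eB))).
have k0 : 0 <= rho ^ n / pi by rewrite divr_ge0 ?exprz_ge0 ?pi_ge0 ?(ltW rho0).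
apply: (@le_trans _ _ (\int[mu]_u (\1_`[0, pi] u * (rho ^ n / pi)))).
  apply: le_Rintegral => //.
  - apply: integrable_norm.
    exact: (integrable_skellam_weight _ (measurable_exp t) eB).
  - by apply: (@integrable_indic_0pi R (fun=> rho ^ n / pi) (rho ^ n / pi)) => // u;
      rewrite ger0_norm.
  - move=> u _; rewrite normrM normrM (ger0_norm (_ : 0 <= \1_`[0, pi] u))//.
    rewrite -mulrA ler_wpM2l// -[leRHS]mulr1 ler_pM//.
    exact: (weight_core_bound n u).
rewrite (_ : (fun u => _) = ((fun=> rho ^ n / pi) \_ `[0, pi])); last first.
  apply/funext => u; rewrite patchE indicE; case: ifP => _; first exact: mul1r.
  exact: mul0r.
rewrite -Rintegral_mkcond Rintegral_cst//= lebesgue_measure_itv/= lte_fin pi_gt0.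
by rewrite -EFinD/= subr0 divfK// gt_eqF// pi_gt0.
Qed.

End skellam_kernel.

Lemma exprz_le_absz (R : realFieldType) (r : R) (n : int) : 0 < r ->
  r ^ n <= (Num.max r r^-1) ^+ `|n|%N.
Proof.
move=> r0; case: n => m /=.
  by rewrite -exprnP lerXn2r ?nnegrE ?le_max ?(ltW r0)// lexx.
rewrite -[leLHS]/(r ^- m.+1) -exprVn; apply: lerXn2r.
- by rewrite nnegrE invr_ge0 ltW.
- by rewrite nnegrE le_max ltW.
- by rewrite le_max lexx orbT.
Qed.

Lemma system_skellam_kernel (R : realType) (a b : R) (p : int -> R -> R) :
  0 < a -> 0 < b ->
  (forall n, p n 0 = (n == 0)%:R) ->
  (forall n, p n x @[x --> 0^'+] --> p n 0) ->
  (forall n (t : R), 0 < t -> is_derive t 1 (p n)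
    (a * (p (n - 1) t - p n t) - b * (p n t - p (n + 1) t))) ->
  (forall n (t : R), 0 <= t -> `|p n t| <= 1) ->
  forall n (t : R), 0 <= t -> p n t = skellam_kernel a b n t.
Proof.
move=> a0 b0 p0 pr pD pB n t t0; apply/eqP; rewrite -subr_eq0; apply/eqP.
(* This c is at least 1, and c^|n| dominates [rho ^ n] for both signs of n. *)
pose rho := Num.sqrt (a / b); pose c := Num.max rho rho^-1.
have rho0 : 0 < rho by rewrite sqrtr_gt0 divr_gt0.
have c1 : 1 <= c.
  rewrite /c le_max; have [//|r1] := leP 1 rho.
  by rewrite invf_ge1// ltW.
(* The constant 2 is one unit for [p] and one for the kernel. *)
apply: (@system_null _ a b c 2
  (fun n t => p n t - skellam_kernel a b n t)) => //; try exact: ltW.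
- by move=> m; rewrite p0 skellam_kernel0// subrr.
- move=> m; apply: cvgB; first exact: pr.
  apply: cvg_at_right_filter.
  apply/differentiable_continuous/derivable1_diffP.
  by have [] := @is_derive_skellam_kernel _ a b a0 b0 m 0.
- move=> m s s0.
  have d1 := is_deriveB (pD m s s0) (@is_derive_skellam_kernel _ a b a0 b0 m s).
  by apply: (is_derive_eq d1); ring.
- move=> m s s0; rewrite (le_trans (ler_normB _ _))// mulrDl mul1r lerD//.
    by rewrite (le_trans (pB _ _ s0))// exprn_ege1.
  rewrite (le_trans (skellam_kernel_le a0 b0 _ s0))//.
  exact: exprz_le_absz.
Qed.

(** * Averaging the kernel over a random time *)

Section subordination.
Context {R : realType} {d : measure_display} {Omega : measurableType d}.
Variables (P : probability Omega R) (a b : R).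
Hypotheses (a0 : 0 < a) (b0 : 0 < b).
Variables (T : Omega -> R) (phi : R -> R).
Hypotheses (mT : measurable_fun setT T) (T0 : forall w, 0 <= T w).
Hypothesis mphi : measurable_fun setT phi.
Hypothesis laplace : forall u,
  (\int[P]_w (expR (- (T w * skellam_rate a b u)))%:E = (phi u)%:E)%E.
Local Notation mu := (@lebesgue_measure R).

Let f n (z : measurableTypeR R * Omega) : R :=
  skellam_weight a b n z.1 * expR (- (T z.2 * skellam_rate a b z.1)).

Lemma measurable_skellam_weight n : measurable_fun setT (skellam_weight a b n).
Proof.
have := measurable_int mu
  (@integrable_skellam_weight _ a b a0 b0 n (cst 1) 1 (measurable_cst _) _).
under [X in measurable_fun _ (EFin \o X)]eq_fun do rewrite mulr1.
by move=> h; apply/measurable_EFinP; apply: h => u; rewrite normr1.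
Qed.

Let exp01 w u : 0 <= expR (- (T w * skellam_rate a b u)) <= 1.
Proof.
by rewrite expR_ge0/= -expR0 ler_expR oppr_le0 mulr_ge0// skellam_rate_ge0.
Qed.

Let measurable_expT u :
  measurable_fun setT (fun w => expR (- (T w * skellam_rate a b u))).
Proof.
apply: measurableT_comp => //; apply: measurableT_comp => //.
exact: measurable_funM.
Qed.

Let measurable_f n : measurable_fun setT (f n).
Proof.
apply: measurable_funM.
  exact: (measurableT_comp (measurable_skellam_weight n) measurable_fst).
apply: measurableT_comp => //; apply: measurableT_comp => //.
apply: measurable_funM.
  exact: (measurableT_comp mT measurable_snd).
exact: (measurableT_comp (@measurable_skellam_rate R a b) measurable_fst).
Qed.

Let integrable_f n : (mu \x P)%E.-integrable setT (EFin \o f n).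
Proof.
apply/integrable12ltyP; first exact/measurable_EFinP.
have iw : mu.-integrable setT (EFin \o skellam_weight a b n).
  have := @integrable_skellam_weight _ a b a0 b0 n (cst 1) 1 (measurable_cst _).
  under [X in integrable _ _ (EFin \o X)]eq_fun do rewrite mulr1.
  by apply => u; rewrite normr1.
case/integrableP: (iw) => mw; apply: le_lt_trans.
apply: ge0_le_integral => //.
- by move=> u _; exact: integral_ge0.
- apply: (measurable_fun_fubini_tonelli_F (fun z => `|(f n z)%:E|)%E) => //.
  by apply/measurableT_comp => //; exact/measurable_EFinP.
- by apply/measurableT_comp => //.
- move=> u _.
  rewrite -[leRHS]mule1 -(@probability_setT _ _ _ P) -[X in (_ <= X)%E]integral_cst//.
  apply: ge0_le_integral => //=.
  + apply/measurable_EFinP; apply: measurableT_comp => //.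
    exact: (measurable_funM (measurable_cst (skellam_weight a b n u)) (measurable_expT u)).
  + move=> w _; rewrite lee_fin /f/= normrM ler_piMr//.
    by have /andP[e0 e1] := exp01 w u; rewrite ger0_norm.
Qed.

(** Fubini: the exponential lies in [0, 1] and P has mass 1, so [f n] is dominated by the weight.
    After the exchange the inner integral is the Laplace transform of [T] at the rate, which is
    [phi]. *)
Lemma subordinated_skellam_kernel n :
  (\int[P]_w (skellam_kernel a b n (T w))%:E =
   (\int[mu]_u (skellam_weight a b n u * phi u))%:E)%E.
Proof.
have eB w u : `|expR (- (T w * skellam_rate a b u))| <= 1.
  by have /andP[e0 e1] := exp01 w u; rewrite ger0_norm.
have phi01 u : 0 <= phi u <= 1.
  rewrite -!lee_fin -laplace; apply/andP; split.
    by apply: integral_ge0 => w _; rewrite lee_fin expR_ge0.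
  rewrite -[leRHS]mul1e -(@probability_setT _ _ _ P) -integral_cst//.
  apply: ge0_le_integral => //=.
  - by apply/measurable_EFinP; exact: measurable_expT.
  - by move=> w _; rewrite probability_setT lee_fin; have /andP[] := exp01 w u.
have mE w : measurable_fun setT (fun u => expR (- (T w * skellam_rate a b u))).
  apply: measurableT_comp => //; apply: measurableT_comp => //.
  by apply: measurable_funM => //; exact: measurable_skellam_rate.
transitivity (\int[P]_w \int[mu]_u (f n (u, w))%:E)%E.
  apply: eq_integral => w _; rewrite /skellam_kernel /Rintegral fineK//.
  exact: (integrable_fin_num measurableT (integrable_skellam_weight a0 b0 n (mE w) (eB w))).
rewrite -(Fubini (integrable_f n)).
rewrite /Rintegral fineK; last first.
  apply: (integrable_fin_num measurableT (@integrable_skellam_weight _ a b a0 b0 n phi 1 mphi _)).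
  by move=> u; have /andP[p0 p1] := phi01 u; rewrite ger0_norm.
apply: eq_integral => u _ /=.
rewrite EFinM -laplace -integralZl//.
apply: (@le_integrable _ _ _ P setT _ _ (EFin \o cst 1)) => //.
- by apply/measurable_EFinP; exact: measurable_expT.
- by move=> w _ /=; rewrite lee_fin normr1.
- exact: finite_measure_integrable_cst.
Qed.

End subordination.

(** * State probabilities at an independent random time *)

Section integer_valued.
Context {R : realType}.

Lemma measurable_int_event (d : measure_display) (Omega : measurableType d)
    (f : Omega -> int) (n : int) :
  measurable_fun setT (fun w => (f w)%:~R : R) -> measurable [set w | f w = n].
Proof.
move=> mf; rewrite (_ : [set _ | _] =
    setT `&` (fun w => (f w)%:~R : R) @^-1` [set n%:~R]); first exact: mf.
rewrite setTI; apply/seteqP; split => [w /= ->//|w /= /eqP].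
by rewrite eqr_int => /eqP.
Qed.

(** Integers at distance less than 1 coincide; for the paths of [S], right continuity thus becomes
    constancy on a right neighbourhood. *)
Lemma cvg_int_near (T : Type) (F : set_system T) (FF : Filter F) (f : T -> int)
    (l : int) :
  (f x)%:~R @[x --> F] --> (l%:~R : R) -> \forall x \near F, f x = l.
Proof.
move=> /cvgrPdist_lt /(_ 1 ltr01); apply: filterS => x.
by rewrite -intrB -intr_norm ltrz1; lia.
Qed.

End integer_valued.

Section bounded_convergence.
Context {R : realType} {d : measure_display} {Omega : measurableType d}.
Variable P : probability Omega R.

Lemma integral_bounded_cvg (Y : nat -> Omega -> R) (y : Omega -> R) :
  (forall k, measurable_fun setT (Y k)) ->
  (forall k w, `|Y k w| <= 1) ->
  (forall w, Y k w @[k --> \oo] --> y w) ->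
  (\int[P]_w (Y k w)%:E)%E @[k --> \oo] --> (\int[P]_w (y w)%:E)%E.
Proof.
move=> mY Y1 Yy.
apply: (@dominated_cvg _ _ _ P setT measurableT (fun k w => (Y k w)%:E)
  (fun w => (y w)%:E) (cst 1%E)) => //.
- by move=> k; exact/measurable_EFinP.
- by move=> w _; apply: cvg_EFin; [exact: nearW|exact: Yy].
- exact: (finite_measure_integrable_cst P 1).
- by move=> k w _ /=; rewrite lee_fin.
Qed.

Lemma integral_bounded_cvg_eq (Y Z : nat -> Omega -> R) (y z : Omega -> R) :
  (forall k, measurable_fun setT (Y k)) ->
  (forall k, measurable_fun setT (Z k)) ->
  (forall k w, `|Y k w| <= 1) -> (forall k w, `|Z k w| <= 1) ->
  (forall w, Y k w @[k --> \oo] --> y w) ->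
  (forall w, Z k w @[k --> \oo] --> z w) ->
  (forall k, \int[P]_w (Y k w)%:E = \int[P]_w (Z k w)%:E)%E ->
  (\int[P]_w (y w)%:E = \int[P]_w (z w)%:E)%E.
Proof.
move=> mY mZ Y1 Z1 Yy Zz YZ.
have := integral_bounded_cvg mZ Z1 Zz.
under eq_fun do rewrite -YZ.
by apply: cvg_unique => //; exact: integral_bounded_cvg.
Qed.

End bounded_convergence.

Section upper_grid.
Context {R : realType}.

Definition grid_index (k : nat) (t : R) : nat := Num.truncn (t * k.+1%:R).

(** The successor in the numerator puts [grid_point k (grid_index k t)] strictly above t, as
    convergence along [t^'+], which excludes t itself, requires. *)
Definition grid_point (k j : nat) : R := j.+1%:R / k.+1%:R.

Lemma grid_point_ge0 k j : 0 <= grid_point k j.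
Proof. by rewrite divr_ge0. Qed.

Lemma grid_point_bounds k (t : R) : 0 <= t ->
  t < grid_point k (grid_index k t) <= t + k.+1%:R^-1.
Proof.
move=> t0; have k0 : (0 : R) < k.+1%:R by rewrite ltr0n.
have := @truncn_itv R (t * k.+1%:R); rewrite mulr_ge0 ?ler0n// => /(_ isT).
move=> /andP[h1 h2]; rewrite /grid_point /grid_index; apply/andP; split.
  by rewrite ltr_pdivlMr.
by rewrite -natr1 mulrDl mul1r lerD2r ler_pdivrMr.
Qed.

Lemma grid_point_cvg (t : R) : 0 <= t ->
  grid_point k (grid_index k t) @[k --> \oo] --> t^'+.
Proof.
move=> t0.
have ct : grid_point k (grid_index k t) @[k --> \oo] --> t.
  apply: (@squeeze_cvgr _ _ _ _ (fun=> t) (fun k => t + k.+1%:R^-1)).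
  - by apply: nearW => k; have /andP[/ltW -> ->] := grid_point_bounds k t0.
  - exact: cvg_cst.
  - rewrite -[X in _ --> X]addr0; apply: cvgD; first exact: cvg_cst.
    exact: cvg_harmonic.
move=> A At; apply: (@filterS nat \oo _ _ _ _ (ct _ At)) => k /=; apply.
by have /andP[] := grid_point_bounds k t0.
Qed.

Lemma measurable_grid_index k j : measurable [set t : R | 0 <= t /\ grid_index k t = j].
Proof.
have k0 : (0 : R) < k.+1%:R by rewrite ltr0n.
rewrite (_ : [set _ | _] = `[j%:R / k.+1%:R, j.+1%:R / k.+1%:R[%classic).
  exact: measurable_itv.
apply/seteqP; split => t /=.
  move=> [t0 <-]; have := @truncn_itv R (t * k.+1%:R).
  rewrite mulr_ge0 ?ler0n// => /(_ isT).
  by rewrite in_itv/= ler_pdivrMr// ltr_pdivlMr.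
rewrite in_itv/= ler_pdivrMr// ltr_pdivlMr// => /andP[h1 h2]; split.
  by rewrite -(pmulr_lge0 _ k0) (le_trans _ h1).
by apply/eqP; rewrite /grid_index truncn_eq ?h1// (le_trans _ h1).
Qed.

End upper_grid.

Lemma measurable_fun_partition (d : measure_display) (Omega : measurableType d)
    (R : realType) (I : Omega -> nat) (f : Omega -> R) (c : nat -> Omega -> R) :
  (forall j, measurable [set w | I w = j]) ->
  (forall j, measurable_fun setT (c j)) ->
  (forall w, f w = c (I w) w) -> measurable_fun setT f.
Proof.
move=> mI mc fc; rewrite (_ : setT = \bigcup_j [set w | I w = j]); last first.
  by apply/seteqP; split => // w _; exists (I w).
apply/(measurable_fun_bigcup f mI) => j.
apply: (@eq_measurable_fun _ _ _ _ _ (c j)).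
  by move=> w /set_mem <-; rewrite fc.
exact: measurable_funTS.
Qed.

Lemma integral_partition (d : measure_display) (Omega : measurableType d)
    (R : realType) (P : {measure set Omega -> \bar R}) (I : Omega -> nat)
    (f : Omega -> R) :
  (forall j, measurable [set w | I w = j]) -> measurable_fun setT f ->
  (forall w, 0 <= f w) ->
  (\int[P]_w (f w)%:E =
   \sum_(j <oo) \int[P]_(w in [set w | I w = j]) (f w)%:E)%E.
Proof.
move=> mI mf f0; rewrite -ge0_integral_bigcup//.
- congr (integral _ _ _); apply/seteqP; split => // w _.
  by exists (I w).
- by apply/measurable_EFinP; exact: measurable_funTS.
- by move=> w _; rewrite lee_fin.
- by move=> i j _ _ [w [/= -> ->]].
Qed.

Section random_time.
Context {R : realType} {d : measure_display} {Omega : measurableType d}.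
Variables (P : probability Omega R) (S : R -> Omega -> int).
Hypothesis mS : forall t n, 0 <= t -> measurable [set w | S t w = n].
Hypothesis rS : forall w t, 0 <= t -> \forall x \near t^'+, S x w = S t w.

Lemma state_probability_bounds n t : 0 <= t ->
  0 <= state_probability P S n t <= 1.
Proof.
move=> t0; rewrite /state_probability /prob; apply/andP; split.
  exact: fine_ge0.
by rewrite -lee_fin fineK ?probability_le1 ?fin_num_measure//; exact: mS.
Qed.

Lemma EFin_state_probability n t : 0 <= t ->
  ((state_probability P S n t)%:E = P [set w | S t w = n])%E.
Proof. by move=> t0; rewrite fineK// fin_num_measure//; exact: mS. Qed.

Let indicator n t w : R := (S t w == n)%:R.

Let indicatorE n t w : indicator n t w = \1_[set w | S t w = n] w.
Proof.
rewrite indicE; congr (_%:R); congr nat_of_bool.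
by apply/eqP/idP => [h|/set_mem//]; exact/mem_set.
Qed.

Let measurable_indicator n t : 0 <= t -> measurable_fun setT (indicator n t).
Proof.
move=> t0; rewrite (_ : indicator n t = \1_[set w | S t w = n]).
  exact/measurable_indic/mS.
by apply/funext => w; exact: indicatorE.
Qed.

Let indicator_cvg n t w (u : nat -> R) : 0 <= t -> u k @[k --> \oo] --> t^'+ ->
  indicator n (u k) w @[k --> \oo] --> indicator n t w.
Proof.
move=> t0 ut; apply: cvg_near_cst.
apply: (@filterS nat \oo _ _ _ _ (ut _ (rS w t0))) => k /= uk.
by rewrite /indicator uk.
Qed.

(** Bounded convergence applied to the indicators of the state, which along any sequence decreasing
    to t are eventually constant on each path. *)
Lemma state_probability_right_continuous n t : 0 <= t ->
  state_probability P S n x @[x --> t^'+] --> state_probability P S n t.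
Proof.
move=> t0; apply/cvg_at_rightP => u [ut uc].
have pE x : 0 <= x ->
    ((state_probability P S n x)%:E = \int[P]_w (indicator n x w)%:E)%E.
  move=> x0; under eq_integral do rewrite indicatorE.
  by rewrite integral_indic ?setIT ?EFin_state_probability//; exact: mS.
have u0 k : 0 <= u k by rewrite (le_trans t0)// ltW.
apply: fine_cvg => /=; rewrite (pE _ t0).
rewrite (_ : (fun x => _) = (fun k => \int[P]_w (indicator n (u k) w)%:E)%E); last first.
  by apply/funext => k /=; rewrite -EFin_state_probability// pE.
apply: integral_bounded_cvg.
- by move=> k; exact: measurable_indicator.
- by move=> k w; rewrite /indicator; case: (_ == _); rewrite ?normr1 ?normr0.
- move=> w; apply: indicator_cvg => // A At.
  by apply: (@filterS nat \oo _ _ _ _ (uc _ At)) => k /=; apply.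
Qed.

Variable T : Omega -> R.
Hypotheses (mT : measurable_fun setT T) (T0 : forall w, 0 <= T w).
Hypothesis indep : forall n t B, 0 <= t -> measurable B ->
  (P ([set w | S t w = n] `&` T @^-1` B) =
   P [set w | S t w = n] * P (T @^-1` B))%E.

Let index k w := grid_index k (T w).

Let time k w : R := grid_point k (index k w).

Let index_preimage k j :
  [set w | index k w = j] = T @^-1` [set t | 0 <= t /\ grid_index k t = j].
Proof. by apply/seteqP; split => [w /= <-//|w /= [_ <-]]. Qed.

Let measurable_index k j : measurable [set w | index k w = j].
Proof.
by rewrite index_preimage -[X in measurable X]setTI; apply: mT => //; exact: measurable_grid_index.
Qed.

Let measurable_time_indicator n k :
  measurable_fun setT (fun w => indicator n (time k w) w).
Proof.
apply: (measurable_fun_partition (measurable_index k)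
  (c := fun j => indicator n (grid_point k j))) => // j.
exact/measurable_indicator/grid_point_ge0.
Qed.

Let measurable_time_probability n k :
  measurable_fun setT (fun w => state_probability P S n (time k w)).
Proof.
apply: (measurable_fun_partition (measurable_index k)
  (c := fun j => cst (state_probability P S n (grid_point k j)))) => // j.
Qed.

(** On the event that the index is j, the time is the constant [grid_point k j] and the event is a
    preimage under [T], so [indep] applies at a fixed time. *)
Let integral_time n k : (\int[P]_w (indicator n (time k w) w)%:E =
  \int[P]_w (state_probability P S n (time k w))%:E)%E.
Proof.
rewrite (integral_partition P (measurable_index k))//.
rewrite [RHS](integral_partition P (measurable_index k))//; last first.
  by move=> w; have /andP[] := @state_probability_bounds n _ (grid_point_ge0 k (index k w)).
apply: eq_eseriesr => j _.
transitivity (\int[P]_(w in [set w | index k w = j])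
    (\1_[set w | S (grid_point k j) w = n] w)%:E)%E.
  by apply: eq_integral => w /set_mem jw; rewrite -indicatorE /time jw.
rewrite integral_indic//; last exact/mS/grid_point_ge0.
transitivity (P ([set w | S (grid_point k j) w = n] `&`
    T @^-1` [set t | 0 <= t /\ grid_index k t = j])); first by rewrite -index_preimage.
rewrite indep ?grid_point_ge0//; last exact: measurable_grid_index.
transitivity (\int[P]_(w in [set w | index k w = j])
    (state_probability P S n (grid_point k j))%:E)%E; last first.
  by apply: eq_integral => w /set_mem jw; rewrite /time jw.
by rewrite integral_cst// -index_preimage EFin_state_probability// grid_point_ge0.
Qed.

(* The grid times decrease to T w from the right, which is the side on which the
   paths of S are continuous; on them the independence of S and T splits P over
   the countably many values of the grid index. *)
Lemma random_time_probability n :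
  ((prob P [set w | S (T w) w = n])%:E =
   \int[P]_w (state_probability P S n (T w))%:E)%E.
Proof.
have Ycvg w : indicator n (time k w) w @[k --> \oo] --> indicator n (T w) w.
  by apply: indicator_cvg => //; exact: grid_point_cvg.
(* The event is a level set of a pointwise limit of measurable indicators at grid times; this stands
   in for joint measurability of [S]. *)
have mE : measurable [set w | S (T w) w = n].
  have mY := measurable_fun_cvg (measurable_time_indicator n) (fun w _ => Ycvg w).
  rewrite (_ : [set _ | _] = setT `&` (fun w => indicator n (T w) w) @^-1` [set 1]).
    exact: mY.
  rewrite setTI /indicator; apply/seteqP; split => w /=.
    by move=> ->; rewrite eqxx.
  by case: eqP => // _ /eqP; rewrite eq_sym oner_eq0.
transitivity (\int[P]_w (indicator n (T w) w)%:E)%E.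
  rewrite /prob fineK ?fin_num_measure//.
  rewrite -[in LHS](setIT [set w | S (T w) w = n]) -integral_indic//.
  apply: eq_integral => w _; congr EFin; rewrite indicE /indicator.
  by congr (nat_of_bool _)%:R; apply/idP/eqP => [/set_mem//|h]; exact/mem_set.
apply: (integral_bounded_cvg_eq (measurable_time_indicator n)
  (measurable_time_probability n)) => //.
- by move=> k w; rewrite /indicator; case: (_ == _); rewrite ?normr1 ?normr0.
- move=> k w; have /andP[p0 p1] := @state_probability_bounds n _ (grid_point_ge0 k (index k w)).
  by rewrite ger0_norm.
- move=> w; apply: (cvg_comp _ _ (grid_point_cvg (T0 w))).
  exact: state_probability_right_continuous.
Qed.

End random_time.

(** * The Skellam process of order one solves the system *)

(* A h, B h, C h stand for the probabilities, divided by h, of leaving the state,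
   of a jump up and of a jump down within time h.  The error in the one-step
   equation is bounded uniformly in t, so that it also controls the left
   difference quotient. *)
Section one_step.
Context {R : realType}.
Variables (a b : R) (p : int -> R -> R) (A B C : R -> R).
Hypotheses (Aa : A h @[h --> 0^'+] --> a + b).
Hypotheses (Ba : B h @[h --> 0^'+] --> a) (Cb : C h @[h --> 0^'+] --> b).
Hypothesis p01 : forall n t, 0 <= t -> 0 <= p n t <= 1.
Hypothesis step : forall n t h, 0 <= t -> 0 < h ->
  let e := (p n (t + h) - p n t) / h
           + A h * p n t - B h * p (n - 1) t - C h * p (n + 1) t in
  0 <= e <= A h - B h - C h.

Let rem_cvg0 : A h - B h - C h @[h --> 0^'+] --> 0.
Proof.
rewrite [X in _ --> X](_ : 0 = a + b - a - b); last by ring.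
by apply: cvgB => //; exact: cvgB.
Qed.

(** The base point may move with h: the constant base t gives the right derivative, and the base t -
    h turns the left quotient into a forward one. *)
Let quotient_cvg n (base : R -> R) (x y z : R) :
  (\forall h \near 0^'+, 0 <= base h) ->
  p n (base h) @[h --> 0^'+] --> x ->
  p (n - 1) (base h) @[h --> 0^'+] --> y ->
  p (n + 1) (base h) @[h --> 0^'+] --> z ->
  (p n (base h + h) - p n (base h)) / h @[h --> 0^'+] -->
    a * (y - x) - b * (x - z).
Proof.
move=> base0 px py pz.
pose l h := - (A h * p n (base h)) + B h * p (n - 1) (base h)
  + C h * p (n + 1) (base h).
have lc : l h @[h --> 0^'+] --> a * (y - x) - b * (x - z).
  have -> : a * (y - x) - b * (x - z) = - ((a + b) * x) + a * y + b * z by ring.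
  by apply: cvgD; [apply: cvgD; [apply: cvgN; exact: cvgM|exact: cvgM]|exact: cvgM].
apply: (@squeeze_cvgr _ _ _ _ l (fun h => l h + (A h - B h - C h))) => //.
  near=> h; have h0 : 0 < h by [].
  have b0 : 0 <= base h by near: h.
  by have /= := step n b0 h0; rewrite /l; lra.
by rewrite -[X in _ --> X]addr0; exact: cvgD.
Unshelve. all: end_near. Qed.

Let id_cvg0 : h @[h --> 0^'+] --> (0 : R).
Proof. by apply: cvg_at_right_filter; exact: cvg_id. Qed.

(** The error bound does not depend on the starting time and all probabilities are at most 1, so the
    change over [t - h, t] is at most [K h], which tends to 0. It provides the limits at the moving
    base t - h. *)
Lemma one_step_left_continuous n t : 0 < t -> p n (t - h) @[h --> 0^'+] --> p n t.
Proof.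
move=> t0.
apply/cvgrPdist_le => e e0.
pose K h := h * ((A h - B h - C h) + (`|A h| + `|B h| + `|C h|)).
have K0 : K h @[h --> 0^'+] --> 0.
  rewrite -[X in _ --> X](mul0r (0 + (`|a + b| + `|a| + `|b|))).
  apply: cvgM => //.
  by apply: cvgD => //; apply: cvgD; [apply: cvgD|]; exact: cvg_norm.
move/cvgrPdist_le : K0 => /(_ _ e0) K0.
near=> h.
have h0 : 0 < h by [].
have ht : 0 <= t - h by rewrite subr_ge0; near: h; exact: nbhs_right_le.
have Ke : `|0 - K h| <= e by near: h.
have := step n ht h0; rewrite /= subrK; set D := (p n t - _) / h => /andP[e1 e2].
have ineq (u v : R) : 0 <= v <= 1 -> `|u * v| <= `|u|.
  by move=> /andP[v0 v1]; rewrite normrM ler_piMr// ger0_norm.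
move: (ineq (A h) _ (p01 n ht)); rewrite ler_norml => /andP[A1 A2].
move: (ineq (B h) _ (p01 (n - 1) ht)); rewrite ler_norml => /andP[B1 B2].
move: (ineq (C h) _ (p01 (n + 1) ht)); rewrite ler_norml => /andP[C1 C2].
have -> : p n t - p n (t - h) = h * D by rewrite /D mulrC divfK// gt_eqF.
clearbody D; apply: le_trans Ke; rewrite sub0r normrN /K !normrM ler_wpM2l//.
rewrite [leRHS]ger0_norm; last by lra.
by rewrite ler_norml; apply/andP; split; lra.
Unshelve. all: end_near. Qed.

Lemma one_step_is_derive n (t : R) : 0 < t -> is_derive t 1 (p n)
  (a * (p (n - 1) t - p n t) - b * (p n t - p (n + 1) t)).
Proof.
move=> t0; set l := (X in is_derive _ _ _ X).
pose q (h : R) : R := h^-1 * (p n (h * 1 + t) - p n t).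
suff dl : q h @[h --> 0^'] --> l.
  by apply: DeriveDef; [apply/cvg_ex; exists l|exact: cvg_lim].
apply: (@cvg_at_right_left_dnbhs R R^o).
  rewrite (_ : q = (fun h => (p n (t + h) - p n t) / h)).
    apply: (quotient_cvg (base := fun=> t)); try exact: cvg_cst.
    by apply: nearW => _; exact: ltW.
  by apply/funext => h; rewrite /q mulr1 [t + h]addrC mulrC.
apply/cvg_at_leftNP; rewrite oppr0.
apply: (@cvg_trans _ ((p n (t - h + h) - p n (t - h)) / h @[h --> 0^'+])).
  apply: near_eq_cvg; near=> h => /=.
  rewrite /q mulr1 [- h + t]addrC.
  by rewrite subrK invrN mulNr -mulrN opprB mulrC.
apply: quotient_cvg; try exact: one_step_left_continuous.
near=> h; rewrite subr_ge0; near: h; exact: nbhs_right_le.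
Unshelve. all: end_near. Qed.

End one_step.

Section counting_process.
Context {R : realType} {d : measure_display} {Omega : measurableType d}.
Variables (P : probability Omega R) (M : R -> Omega -> nat).
Hypothesis lM : levy_process P (fun t w => (M t w)%:R).

Lemma measurable_count_event t m : 0 <= t -> measurable [set w | M t w = m].
Proof.
move=> t0; have mM := levy_measurable lM t0.
rewrite (_ : [set _ | _] = setT `&` (fun w => (M t w)%:R : R) @^-1` [set m%:R]).
  exact: mM.
rewrite setTI; apply/seteqP; split => [w /= ->//|w /= /eqP].
by rewrite eqr_nat => /eqP.
Qed.

Lemma count_increment t h m i : 0 <= t -> 0 <= h ->
  prob P [set w | M t w = m /\ M (t + h) w = (m + i)%N] =
  prob P [set w | M t w = m] * prob P [set w | M h w = i].
Proof.
move=> t0 h0.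
(* Nodes 0, t, t + h; the default value keeps the sequence constant from then on, hence
   nondecreasing at every index. Likewise the default in [A] makes its second set {i}. *)
pose tau (k : nat) : R := nth (t + h) [:: 0; t] k.
have tau_le k : tau k <= tau k.+1.
  by case: k => [|[|k]]//; rewrite /tau/= ?lerDl// nth_nil.
pose A (k : 'I_2) : set R := [set (nth i [:: m] k)%:R].
have mA k : measurable (A k) by exact: measurable_set1.
have := @levy_indep_increments _ _ _ _ _ lM 2 tau (lexx 0) tau_le A mA.
rewrite 2!big_ord_recl big_ord0 mulr1 /=.
have M0 w : (M 0 w)%:R = 0 :> R := levy_start lM w.
have natB (x y z : nat) : (x%:R - y%:R = z%:R :> R) <-> x = (y + z)%N.
  split=> [/eqP|->]; last by rewrite natrD addrAC subrr add0r.
  by rewrite subr_eq addrC -natrD eqr_nat => /eqP.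
rewrite /tau /A /=.
rewrite [X in prob P X = _](_ : _ =
    [set w | M t w = m /\ M (t + h) w = (m + i)%N]); last first.
  apply/seteqP; split => w /=.
    move=> hw; have := hw (@Ordinal 2 0 isT); have := hw (@Ordinal 2 1 isT).
    rewrite !inE/= M0 subr0 => /natB h1 /eqP; rewrite eqr_nat => /eqP h2.
    by rewrite h1 h2.
  move=> [h1 h2] [[|[|k]] kl]//; rewrite inE/=.
    by rewrite M0 subr0 h1.
  by apply/natB; rewrite h2 h1.
move=> ->; congr (_ * _).
  congr (prob P _); apply/seteqP; split => w /=.
    by rewrite inE/= M0 subr0 => /eqP; rewrite eqr_nat => /eqP.
  by move=> ->; rewrite inE/= M0 subr0.
have := levy_stationary_increments lM t0 h0 (measurable_set1 (i%:R : R)).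
move=> e; rewrite -[RHS](_ : prob P [set w | (M h w)%:R \in [set i%:R : R]] = _).
  by rewrite -e; congr (prob P _).
congr (prob P _); apply/seteqP; split => w /=.
  by rewrite inE/= => /eqP; rewrite eqr_nat => /eqP.
by move=> ->; rewrite inE.
Qed.

End counting_process.

Lemma measure_partition (d : measure_display) (Omega : measurableType d)
    (R : realType) (P : {measure set Omega -> \bar R}) (I : Omega -> nat)
    (E : set Omega) :
  (forall j, measurable [set w | I w = j]) -> measurable E ->
  (P E = \sum_(j <oo) P (E `&` [set w | I w = j]))%E.
Proof.
move=> mI mE.
have -> : (P E = P (\bigcup_j (E `&` [set w | I w = j])))%E.
  congr (P _); apply/seteqP; split => [w Ew|w [j _ []//]].
  by exists (I w).
rewrite measure_bigcup//.
- by apply: eq_eseriesl => j; rewrite in_setT.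
- by move=> j _; exact: measurableI.
- by move=> j l _ _ [w [[_ /= <-] [_ /= <-]]].
Qed.

Section counting_pair.
Context {R : realType} {d : measure_display} {Omega : measurableType d}.
Variables (P : probability Omega R) (M1 M2 : R -> Omega -> nat).
Hypothesis lM1 : levy_process P (fun t w => (M1 t w)%:R).
Hypothesis lM2 : levy_process P (fun t w => (M2 t w)%:R).
Hypothesis indep : independent_processes P
  (fun t w => (M1 t w)%:R) (fun t w => (M2 t w)%:R).

Let mM1 t m : 0 <= t -> measurable [set w | M1 t w = m].
Proof. exact: (measurable_count_event lM1). Qed.

Let mM2 t m : 0 <= t -> measurable [set w | M2 t w = m].
Proof. exact: (measurable_count_event lM2). Qed.

Let cylinder (M : R -> Omega -> nat) t h m n :
  [set w | forall k : 'I_2, (M (nth t [:: t; t + h] k) w)%:R \in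
     [set (nth m [:: m; n] k)%:R : R]] = [set w | M t w = m /\ M (t + h) w = n].
Proof.
apply/seteqP; split => w /=.
  move=> hw; have := hw (@Ordinal 2 0 isT); have := hw (@Ordinal 2 1 isT).
  by rewrite !inE/= => /eqP; rewrite eqr_nat => /eqP -> /eqP; rewrite eqr_nat => /eqP ->.
by move=> [h1 h2] [[|[|k]] kl]//; rewrite inE/= ?h1 ?h2.
Qed.

Let pair_cylinder t h m m' n n' : 0 <= t -> 0 <= h ->
  prob P ([set w | M1 t w = m /\ M1 (t + h) w = n] `&`
          [set w | M2 t w = m' /\ M2 (t + h) w = n']) =
  prob P [set w | M1 t w = m /\ M1 (t + h) w = n] *
  prob P [set w | M2 t w = m' /\ M2 (t + h) w = n'].
Proof.
move=> t0 h0; rewrite -!cylinder; apply: indep => [[[|[|k]] kl]|[[|[|k]] kl]|k|k]//=;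
  by rewrite ?addr_ge0.
Qed.

(* Coding pairs of states by pickle reduces the sum over both states to a single
   countable partition. *)
Let pair_index t w : nat := pickle (M1 t w, M2 t w).

Let pair_indexP t w w0 : pair_index t w = pair_index t w0 <->
  M1 t w = M1 t w0 /\ M2 t w = M2 t w0.
Proof.
split=> [|[e1 e2]]; last by rewrite /pair_index e1 e2.
by move=> /(pcan_inj pickleK) [-> ->].
Qed.

Let measurable_pair_index t j : 0 <= t -> measurable [set w | pair_index t w = j].
Proof.
move=> t0; have [[w0 w0j]|nj] := pselect (exists w, pair_index t w = j); last first.
  by rewrite (_ : [set _ | _] = set0)// -subset0 => w wj; apply: nj; exists w.
rewrite (_ : [set _ | _] = [set w | M1 t w = M1 t w0] `&` [set w | M2 t w = M2 t w0]).
  by apply: measurableI; [exact: mM1|exact: mM2].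
by rewrite -w0j; apply/seteqP; split => w /= /pair_indexP.
Qed.

(** A relation [V] is used because one value of the difference M1 - M2 corresponds to infinitely
    many pairs of states. *)
Definition pair_state (V : nat -> nat -> Prop) t :=
  [set w | V (M1 t w) (M2 t w)].

Definition pair_jump t h (i j : nat) :=
  [set w | M1 (t + h) w = (M1 t w + i)%N /\ M2 (t + h) w = (M2 t w + j)%N].

Lemma measurable_pair_state V t : 0 <= t -> measurable (pair_state V t).
Proof.
move=> t0; rewrite (_ : pair_state V t = \bigcup_j
    (pair_state V t `&` [set w | pair_index t w = j])); last first.
  by apply/seteqP; split => [w Vw|w [j _ []//]]; exists (pair_index t w).
apply: bigcup_measurable => j _.
have [[w0 [V0 w0j]]|nj] := pselect (exists w, V (M1 t w) (M2 t w) /\ pair_index t w = j).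
  rewrite (_ : _ `&` _ = [set w | pair_index t w = j]).
    exact: measurable_pair_index.
  apply/seteqP; split => [w []//|w wj]; split => //.
  by move: wj; rewrite /pair_state/= -w0j => /pair_indexP [-> ->].
by rewrite (_ : _ `&` _ = set0)// -subset0 => w [Vw wj]; apply: nj; exists w.
Qed.

Lemma measurable_pair_jump t h i j : 0 <= t -> 0 <= h -> measurable (pair_jump t h i j).
Proof.
move=> t0 h0; have th0 : 0 <= t + h by exact: addr_ge0.
rewrite (_ : pair_jump t h i j = \bigcup_l (pair_jump t h i j `&` [set w | pair_index t w = l])); last first.
  by apply/seteqP; split => [w Vw|w [l _ []//]]; exists (pair_index t w).
apply: bigcup_measurable => l _.
have [[w0 w0l]|nl] := pselect (exists w, pair_index t w = l); last first.
  by rewrite (_ : _ `&` _ = set0)// -subset0 => w [_ wj]; apply: nl; exists w.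
rewrite (_ : _ `&` _ = [set w | M1 (t + h) w = (M1 t w0 + i)%N] `&`
  [set w | M2 (t + h) w = (M2 t w0 + j)%N] `&` [set w | pair_index t w = l]).
  apply: measurableI; last exact: measurable_pair_index.
  by apply: measurableI; [exact: mM1|exact: mM2].
rewrite -w0l; apply/seteqP; split => w [+ wl]; move: (wl) => /pair_indexP[e1 e2].
  by move=> [/= h1 h2]; rewrite -e1 -e2.
by move=> [/= h1 h2]; rewrite /pair_jump/= e1 e2.
Qed.

(** The Markov property of the pair. For each single state at time t, independence of the two
    processes separates them and independence of increments separates past from jump; summing over
    the states in [V] gives the claim. *)
Lemma pair_state_jump V t h i j : 0 <= t -> 0 <= h ->
  prob P (pair_state V t `&` pair_jump t h i j) =
  prob P (pair_state V t) * (prob P [set w | M1 h w = i] * prob P [set w | M2 h w = j]).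
Proof.
move=> t0 h0; set c := prob P _ * prob P _.
have c0 : 0 <= c by rewrite mulr_ge0 ?fine_ge0.
have mV := measurable_pair_state V t0.
suff e : (P (pair_state V t `&` pair_jump t h i j) = c%:E * P (pair_state V t))%E.
  rewrite {1}/prob e fineM//; last exact: fin_num_measure.
  by rewrite /prob/= [LHS]mulrC.
have mI l := @measurable_pair_index t l t0.
have mJ := measurable_pair_jump i j t0 h0.
rewrite (measure_partition P mI (measurableI _ _ mV mJ)) (measure_partition P mI mV).
rewrite -nneseriesZl//.
apply: eq_eseriesr => l _.
have [[w0 [V0 w0l]]|nl] := pselect (exists w, V (M1 t w) (M2 t w) /\ pair_index t w = l); last first.
  rewrite (_ : _ `&` _ = set0); last first.
    by rewrite -subset0 => w [[Vw _] wj]; apply: nl; exists w.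
  rewrite (_ : pair_state V t `&` _ = set0) ?measure0 ?mule0//.
  by rewrite -subset0 => w [Vw wj]; apply: nl; exists w.
set m := M1 t w0; set m' := M2 t w0.
have -> : pair_state V t `&` pair_jump t h i j `&` [set w | pair_index t w = l] =
    [set w | M1 t w = m /\ M1 (t + h) w = (m + i)%N] `&`
    [set w | M2 t w = m' /\ M2 (t + h) w = (m' + j)%N].
  rewrite -w0l; apply/seteqP; split => w /=.
    by move=> [[_ [h1 h2]] /pair_indexP[e1 e2]]; rewrite h1 h2 e1 e2.
  move=> [[e1 h1] [e2 h2]]; split; last exact/pair_indexP.
  by split; rewrite ?/pair_state ?/pair_jump/= ?e1 ?e2// h1 h2.
(* The one-time event is written as a two-time cylinder with zero step, so that [pair_cylinder]
   applies on both sides. *)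
have -> : pair_state V t `&` [set w | pair_index t w = l] =
    [set w | M1 t w = m /\ M1 (t + 0) w = (m + 0)%N] `&`
    [set w | M2 t w = m' /\ M2 (t + 0) w = (m' + 0)%N].
  rewrite addr0 !addn0 -w0l; apply/seteqP; split => w /=.
    by move=> [_ /pair_indexP[-> ->]].
  move=> [[e1 _] [e2 _]]; split; last exact/pair_indexP.
  by rewrite /pair_state/= e1 e2.
have mC1 s n : 0 <= s -> measurable [set w | M1 t w = m /\ M1 (t + s) w = n].
  by move=> s0; apply: measurableI; apply: mM1 => //; exact: addr_ge0.
have mC2 s n : 0 <= s -> measurable [set w | M2 t w = m' /\ M2 (t + s) w = n].
  by move=> s0; apply: measurableI; apply: mM2 => //; exact: addr_ge0.
rewrite -[LHS]fineK; last by rewrite fin_num_measure//; apply: measurableI; auto.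
rewrite -[X in (_ * X)%E]fineK; last by rewrite fin_num_measure//; apply: measurableI; auto.
rewrite -EFinM; congr EFin.
rewrite -!/(prob P _) !pair_cylinder// (count_increment lM1)// (count_increment lM2)//.
rewrite addr0 !addn0.
have dup (M : R -> Omega -> nat) n : [set w | M t w = n /\ M t w = n] = [set w | M t w = n].
  by apply/seteqP; split => w /= => [[]|].
by rewrite !dup /c; ring.
Qed.

Lemma pair_jump_probability t h i j : 0 <= t -> 0 <= h ->
  prob P (pair_jump t h i j) =
  prob P [set w | M1 h w = i] * prob P [set w | M2 h w = j].
Proof.
move=> t0 h0; have := pair_state_jump (fun _ _ => True) i j t0 h0.
have -> : pair_state (fun _ _ => True) t = setT by apply/seteqP.
by rewrite setTI => ->; rewrite /prob probability_setT mul1r.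
Qed.

End counting_pair.

Section disjoint_cover.
Context {R : realType} {d : measure_display} {Omega : measurableType d}.
Variable P : probability Omega R.

Lemma prob_setD (A B : set Omega) : measurable A -> measurable B ->
  prob P (A `\` B) = prob P A - prob P (A `&` B).
Proof.
move=> mA mB; have mI := measurableI _ _ mA mB; have mD := measurableD mA mB.
rewrite /prob (measureDI P mA mB) fineD ?fin_num_measure//; last first.
by rewrite addrK.
Qed.

Lemma prob_le (A B : set Omega) : measurable A -> measurable B ->
  A `<=` B -> prob P A <= prob P B.
Proof. by move=> mA mB AB; rewrite fine_le ?fin_num_measure// le_measure ?inE. Qed.

(** The middle term is the probability of the part of [G] outside the three events, which is at most
    that of their common complement. With [G] a state at time t + h and the events no jump, one jump
    up, one jump down, it bounds the one-step error by the probability of any other transition. *)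
Lemma prob_disjoint3 (J1 J2 J3 G : set Omega) :
  measurable J1 -> measurable J2 -> measurable J3 -> measurable G ->
  J1 `&` J2 = set0 -> J1 `&` J3 = set0 -> J2 `&` J3 = set0 ->
  0 <= prob P G - prob P (G `&` J1) - prob P (G `&` J2) - prob P (G `&` J3)
    <= 1 - prob P J1 - prob P J2 - prob P J3.
Proof.
move=> m1 m2 m3 mG J12 J13 J23.
have rest X : measurable X -> prob P (X `\` J1 `\` J2 `\` J3) =
    prob P X - prob P (X `&` J1) - prob P (X `&` J2) - prob P (X `&` J3).
  move=> mX; have mX1 := measurableD mX m1; have mX2 := measurableD mX1 m2.
  have miss (A B J : set Omega) : J `&` B = set0 -> (A `\` J) `&` B = A `&` B.
    move=> JB; apply/seteqP; split => w [].
      by move=> [].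
    move=> Aw Bw; split => //; split => // Jw.
    by have : set0 w by rewrite -JB.
  by rewrite !prob_setD// !miss.
rewrite -rest//; apply/andP; split; first exact: fine_ge0.
have := rest setT measurableT; rewrite !setTI.
rewrite {2}/prob probability_setT /= => <-.
apply: prob_le.
- by do 3 apply: measurableD => //.
- by do 3 apply: measurableD => //.
- by do 3 apply: setSD.
Qed.

End disjoint_cover.

Section skellam_system.
Context {R : realType} {d : measure_display} {Omega : measurableType d}.
Variables (P : probability Omega R) (M1 M2 : R -> Omega -> nat).
Variables (S : R -> Omega -> int) (a b : R).
Hypothesis lM1 : levy_process P (fun t w => (M1 t w)%:R).
Hypothesis lM2 : levy_process P (fun t w => (M2 t w)%:R).
Hypothesis indep : independent_processes P
  (fun t w => (M1 t w)%:R) (fun t w => (M2 t w)%:R).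
Hypothesis SE : forall t w, 0 <= t -> S t w = (M1 t w)%:Z - (M2 t w)%:Z.

Lemma skellam_measurable t : 0 <= t ->
  measurable_fun setT (fun w => (S t w)%:~R : R).
Proof.
move=> t0; rewrite (_ : (fun w => _) = (fun w => (M1 t w)%:R - (M2 t w)%:R)).
  by apply: measurable_funB; [exact: (levy_measurable lM1)|exact: (levy_measurable lM2)].
by apply/funext => w; rewrite SE// intrB.
Qed.

Lemma skellam_right_continuous w t : 0 <= t ->
  (S x w)%:~R @[x --> t^'+] --> ((S t w)%:~R : R).
Proof.
move=> t0; rewrite SE// intrB.
apply: (@cvg_trans _ ((M1 x w)%:R - (M2 x w)%:R @[x --> t^'+])); last first.
  by apply: cvgB; [exact: (levy_right_continuous lM1)|exact: (levy_right_continuous lM2)].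
apply: near_eq_cvg; near=> x; rewrite SE ?intrB//.
by rewrite (le_trans t0).
Unshelve. all: end_near. Qed.

Hypothesis jump1 : (prob P [set w | M1 h w = 1%N] / h) @[h --> 0^'+] --> a.
Hypothesis stay1 : ((1 - prob P [set w | M1 h w = 0%N]) / h) @[h --> 0^'+] --> a.
Hypothesis jump2 : (prob P [set w | M2 h w = 1%N] / h) @[h --> 0^'+] --> b.
Hypothesis stay2 : ((1 - prob P [set w | M2 h w = 0%N]) / h) @[h --> 0^'+] --> b.

Let stay_cvg (M : R -> Omega -> nat) (c : R) :
  ((1 - prob P [set w | M h w = 0%N]) / h) @[h --> 0^'+] --> c ->
  prob P [set w | M h w = 0%N] @[h --> 0^'+] --> (1 : R).
Proof.
move=> hc.
have h0 : h @[h --> 0^'+] --> (0 : R).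
  by apply: cvg_at_right_filter; exact: cvg_id.
have : 1 - h * ((1 - prob P [set w | M h w = 0%N]) / h) @[h --> 0^'+] --> 1 - 0 * c.
  by apply: cvgB; [exact: cvg_cst|exact: cvgM].
rewrite mul0r subr0; apply: cvg_trans; apply: near_eq_cvg; near=> h.
by rewrite mulrC divfK ?subKr// gt_eqF.
Unshelve. all: end_near. Qed.

Let p := state_probability P S.

Let pE n t : 0 <= t ->
  p n t = prob P (pair_state M1 M2 (fun m m' => m%:Z - m'%:Z = n) t).
Proof.
move=> t0; rewrite /p /state_probability; congr (prob P _).
by apply/seteqP; split => w; rewrite /pair_state/= SE.
Qed.

Let q1 h i := prob P [set w | M1 h w = i].
Let q2 h i := prob P [set w | M2 h w = i].

Let one_step n t h : 0 <= t -> 0 < h ->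
  0 <= (p n (t + h) - p n t) / h + (1 - q1 h 0%N * q2 h 0%N) / h * p n t
    - (q1 h 1%N / h * q2 h 0%N) * p (n - 1) t
    - (q1 h 0%N * (q2 h 1%N / h)) * p (n + 1) t
  <= (1 - q1 h 0%N * q2 h 0%N) / h - q1 h 1%N / h * q2 h 0%N
    - q1 h 0%N * (q2 h 1%N / h).
Proof.
move=> t0 h0; set e := (X in _ <= X <= _); have h0' := ltW h0.
have th0 : 0 <= t + h by exact: addr_ge0.
pose V n (m m' : nat) := m%:Z - m'%:Z = n.
pose J i j := pair_jump M1 M2 t h i j.
have mJ i j : measurable (J i j) by exact: (measurable_pair_jump lM1 lM2 i j t0 h0').
have dJ i j i' j' : (i, j) != (i', j') -> J i j `&` J i' j' = set0.
  move=> ij; rewrite -subset0 => w [[e1 e2] [e3 e4]].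
  move: ij; rewrite xpair_eqE.
  by rewrite -(eqn_add2l (M1 t w)) -e1 e3 eqxx -(eqn_add2l (M2 t w)) -e2 e4 eqxx.
(* Reaching n after i steps up and j steps down means starting from n - i + j. *)
have GJ i j : pair_state M1 M2 (V n) (t + h) `&` J i j =
    pair_state M1 M2 (V (n - i%:Z + j%:Z)) t `&` J i j.
  apply/seteqP; split => w [Vw [e1 e2]]; split; rewrite ?/pair_jump//= /pair_state/V/=.
    by move: Vw; rewrite /pair_state/V/= e1 e2; lia.
  by rewrite e1 e2; move: Vw; rewrite /pair_state/V/=; lia.
have := prob_disjoint3 P (mJ 0%N 0%N) (mJ 1%N 0%N) (mJ 0%N 1%N)
  (measurable_pair_state lM1 lM2 (V n) th0) (dJ 0%N 0%N 1%N 0%N isT)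
  (dJ 0%N 0%N 0%N 1%N isT) (dJ 1%N 0%N 0%N 1%N isT).
rewrite !GJ !(pair_state_jump lM1 lM2 indep)// !(pair_jump_probability lM1 lM2 indep)//.
have pV m s : 0 <= s -> prob P (pair_state M1 M2 (V m) s) = p m s.
  by move=> s0; rewrite pE.
rewrite !pV// (_ : n - 0%:Z + 0%:Z = n); last by lia.
rewrite (_ : n - 1%:Z + 0%:Z = n - 1); last by lia.
rewrite (_ : n - 0%:Z + 1%:Z = n + 1); last by lia.
rewrite -/(q1 h 0%N) -/(q2 h 0%N) -/(q1 h 1%N) -/(q2 h 1%N).
move=> /andP[]; set x := (X in 0 <= X) => x0; set y := (X in _ <= X) => xy.
have -> : e = x / h by rewrite /e /x; field; rewrite gt_eqF.
have -> : (1 - q1 h 0%N * q2 h 0%N) / h - q1 h 1%N / h * q2 h 0%N - q1 h 0%N * (q2 h 1%N / h) = y / h.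
  by rewrite /y; field; rewrite gt_eqF.
by rewrite divr_ge0// ler_pM2r ?invr_gt0.
Qed.

Lemma skellam_state_system : state_system P a b S.
Proof.
split=> [n|n t t0].
  rewrite /state_probability (_ : [set w | _] = if n == 0 then setT else set0).
    by case: (n == 0); rewrite /prob ?probability_setT ?measure0.
  have S0 w : S 0 w = 0.
    have M10 : (M1 0 w)%:R = 0 :> R := levy_start lM1 w.
    have M20 : (M2 0 w)%:R = 0 :> R := levy_start lM2 w.
    move/eqP: M10; rewrite pnatr_eq0 => /eqP M10.
    move/eqP: M20; rewrite pnatr_eq0 => /eqP M20.
    by rewrite SE// M10 M20.
  case: eqP => [->|n0]; apply/seteqP; split => w //=.
  by rewrite S0 => /esym.
apply: (@one_step_is_derive _ a b p
  (fun h => (1 - q1 h 0%N * q2 h 0%N) / h) (fun h => q1 h 1%N / h * q2 h 0%N)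
  (fun h => q1 h 0%N * (q2 h 1%N / h))) => //.
(* From 1 - q1 q2 = (1 - q1) + q1 (1 - q2), with q1 tending to 1, the rate of leaving is a + b. *)
- rewrite (_ : (fun h => _) =
      (fun h => (1 - q1 h 0%N) / h + q1 h 0%N * ((1 - q2 h 0%N) / h))); last first.
    by apply/funext => h; ring.
  rewrite -[X in _ --> a + X]mul1r.
  by apply: cvgD => //; apply: cvgM => //; exact: (stay_cvg stay1).
- by rewrite -[X in _ --> X]mulr1; apply: cvgM => //; exact: (stay_cvg stay2).
- by rewrite -[X in _ --> X]mul1r; apply: cvgM => //; exact: (stay_cvg stay1).
- move=> m s s0; apply: state_probability_bounds => //.
  move=> s' m' s'0; apply: (@measurable_int_event R).
  exact: skellam_measurable.
Qed.

End skellam_system.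

(** * Superpositions of real exponentials *)

Lemma cexp_real (R : realType) (t x : R) :
  cexp (- (t%:C * x%:C)) = (expR (- (t * x)))%:C.
Proof.
by rewrite -rmorphM -rmorphN /cexp/= cos0 sin0 mulr1 mulr0.
Qed.

Lemma principal_pow_real (R : realType) (x a : R) : 0 <= x ->
  principal_pow x%:C a = (x `^ a)%:C.
Proof.
move=> x0; rewrite /principal_pow/= mul0r atan0 mulr0 cos0 sin0 mulr1 mulr0.
by rewrite expr0n/= addr0 sqrtr_sqr ger0_norm.
Qed.

Section real_superposition.
Context {R : realType} {d : measure_display} {U : measurableType d}.
Variable m : {measure set U -> \bar R}.

Lemma cintegrable_real (f : U -> R) :
  m.-integrable setT (EFin \o f) -> cintegrable m (fun x => (f x)%:C).
Proof. by move=> fi; split => //=; exact: integrable0. Qed.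

Lemma cintegral_real (f : U -> R) :
  cintegral m (fun x => (f x)%:C) = (\int[m]_x f x)%:C.
Proof.
rewrite /cintegral/=; congr (_ +i* _).
by rewrite /Rintegral integral0.
Qed.

(** For real rates above -eta^theta the base eta^theta + psi is positive, where the principal branch
    is the real power; all imaginary parts then vanish. *)
Lemma frac_shifted_derivative_real (eta theta : R) (v psi : U -> R)
    (f g : R -> R) :
  measurable_fun setT psi -> (forall x, - (eta `^ theta) < psi x) ->
  (forall t, 0 <= t ->
    let e x := v x * expR (- (t * psi x)) in
    let e' x := v x * ((eta `^ theta + psi x) `^ theta^-1 * expR (- (t * psi x))) in
    [/\ m.-integrable setT (EFin \o e), f t = \int[m]_x e x,
        m.-integrable setT (EFin \o e') & g t = \int[m]_x e' x]) ->
  frac_shifted_derivative eta theta (fun t => (f t)%:C) (fun t => (g t)%:C).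
Proof.
move=> mpsi psi_gt fg.
exists d, U, m, (fun x => (v x)%:C), (fun x => (psi x)%:C); split => //.
move=> t t0 e e'; have [ie fe ie' ge] := fg t t0.
have -> : e = (fun x => (v x * expR (- (t * psi x)))%:C).
  by apply/funext => x; rewrite /e cexp_real -rmorphM.
have -> : e' = (fun x =>
    (v x * ((eta `^ theta + psi x) `^ theta^-1 * expR (- (t * psi x))))%:C).
  apply/funext => x; rewrite /e' cexp_real -rmorphD principal_pow_real -?rmorphM//.
  by rewrite -lerBlDl sub0r ltW.
by split; rewrite ?cintegral_real ?fe ?ge//; exact: cintegrable_real.
Qed.

End real_superposition.

Section tempered_stable_exponent.
Context {R : realType}.
Variables (eta theta : R).
Hypotheses (eta0 : 0 < eta) (theta0 : 0 < theta).

Definition tempered_exponent (x : R) : R := (eta + x) `^ theta - eta `^ theta.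

Lemma tempered_exponent_ge0 x : 0 <= x -> 0 <= tempered_exponent x.
Proof.
move=> x0; have e0 := ltW eta0.
by rewrite subr_ge0 ge0_ler_powR ?nnegrE ?addr_ge0 ?lerDl ?(ltW theta0).
Qed.

Lemma tempered_exponentK x : 0 <= x ->
  (eta `^ theta + tempered_exponent x) `^ theta^-1 = eta + x.
Proof.
move=> x0; rewrite addrC subrK -powRrM mulfV ?gt_eqF// powRr1//.
by rewrite addr_ge0// ltW.
Qed.

End tempered_stable_exponent.

Theorem proposition3p4 (R : realType) (k : nat) (hk : (1 <= k)%N)
    (lam mu : 'I_k -> R)
    (hlam : forall j, 0 < lam j) (hmu : forall j, 0 < mu j)
    (d : measure_display) (Omega : measurableType d)
    (P : probability Omega R)
    (S : R -> Omega -> int)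
    (hS : (k = 1%N /\ generalized_skellam_process P lam mu S) \/
          (levy_process P (fun t w => (S t w)%:~R) /\
           state_system P (\sum_(j < k) lam j) (\sum_(j < k) mu j) S))
    (eta theta : R) (heta : 0 < eta) (htheta0 : 0 < theta) (htheta1 : theta < 1)
    (D : R -> Omega -> R)
    (hD : tempered_stable_subordinator P eta theta D)
    (hSD : independent_processes P (fun t w => (S t w)%:~R) D) :
  let L := \sum_(j < k) lam j in
  let L' := \sum_(j < k) mu j in
  let pf2 := fun (n : int) (t : R) => prob P [set w | S (D t w) w = n] in
  forall n : int,
    frac_shifted_derivative eta theta
      (fun t => (pf2 n t)%:C)
      (fun t => ((eta + L + L') * pf2 n t - L * pf2 (n - 1) t
                 - L' * pf2 (n + 1) t)%:C).
Proof.
move=> L L' pf2 n.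
have sum_gt0 (r : 'I_k -> R) : (forall j, 0 < r j) -> 0 < \sum_(j < k) r j.
  move=> r0; rewrite (bigD1 (Ordinal hk))//= ltr_wpDr//.
  by apply: sumr_ge0 => j _; exact: ltW.
have L0 : 0 < L := sum_gt0 _ hlam; have L'0 : 0 < L' := sum_gt0 _ hmu.
(* Common ground of the two alternatives of [hS]. For k = 1 each sum of rates is the single rate of
   jumps of size 1. *)
have [mS rS sS] : [/\ forall t : R, 0 <= t -> measurable_fun setT (fun w => (S t w)%:~R : R),
    forall w (t : R), 0 <= t -> (S x w)%:~R @[x --> t^'+] --> ((S t w)%:~R : R) &
    state_system P L L' S].
  case: hS => [[k1 [M1 [M2 [[lM1 j1 n1] [lM2 j2 n2] iM SE]]]]|[lS sS]]; last first.
    split=> //; [exact: (levy_measurable lS)|exact: (levy_right_continuous lS)].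
  split; [exact: (skellam_measurable lM1 lM2 SE)|exact: (skellam_right_continuous lM1 lM2 SE)|].
  have sum1 (r : 'I_k -> R) : \sum_(j < k) r j = r (Ordinal hk).
    by subst k; rewrite big_ord1; congr (r _); exact: val_inj.
  move: n1 n2; rewrite /L /L' !sum1 => n1 n2.
  by apply: (skellam_state_system lM1 lM2 iM SE) => //; [exact: j1|exact: j2].
have mSn t m : 0 <= t -> measurable [set w | S t w = m].
  by move=> /mS; exact: measurable_int_event.
have rSn w t : 0 <= t -> \forall x \near t^'+, S x w = S t w.
  by move=> /(rS w); exact: cvg_int_near.
have p01 m t : 0 <= t -> `|state_probability P S m t| <= 1.
  by move=> t0; have /andP[? ?] := state_probability_bounds P mSn m t0; rewrite ger0_norm.
have pE := system_skellam_kernel L0 L'0 sS.1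
  (fun m => @state_probability_right_continuous _ _ _ P S mSn rSn m 0 (lexx 0)) sS.2 p01.
have [lD monoD lapD] := hD.
have D0 w t : 0 <= t -> 0 <= D t w.
  by move=> t0; rewrite -(levy_start lD w); exact: monoD.
have mD t : 0 <= t -> measurable_fun setT (D t) := @levy_measurable _ _ _ _ _ lD t.
pose psi u := tempered_exponent eta theta (skellam_rate L L' u).
pose phi t u := expR (- (t * psi u)).
have psi0 u : 0 <= psi u by exact/tempered_exponent_ge0/skellam_rate_ge0.
have mpsi : measurable_fun setT psi.
  apply: measurable_funB => //.
  apply: (measurableT_comp (measurable_powR theta)).
  by apply: measurable_funD => //; exact: measurable_skellam_rate.
have mphi t : measurable_fun setT (phi t).
  apply: measurableT_comp => //; apply: measurableT_comp => //.
  exact: measurable_funM.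
have phi1 t u : 0 <= t -> `|phi t u| <= 1.
  by move=> t0; rewrite ger0_norm ?expR_ge0// -expR0 ler_expR oppr_le0 mulr_ge0.
(* The Laplace transform of [D t] is given at positive arguments; the rate is 0 when L = L' and cos
   u = 1, where both sides equal 1. *)
have laplace t u : 0 <= t ->
    (\int[P]_w (expR (- (D t w * skellam_rate L L' u)))%:E = (phi t u)%:E)%E.
  move=> t0; have := skellam_rate_ge0 L0 L'0 u; rewrite le_eqVlt => /predU1P[r0|r0].
    rewrite /phi /psi /tempered_exponent -r0 addr0 subrr mulr0 oppr0 expR0.
    under eq_integral do rewrite mulr0 oppr0 expR0.
    by rewrite integral_cst//= probability_setT mule1.
  have := lapD _ _ r0 t0; rewrite expectation.unlock mulNr => <-.
  apply: eq_integral => w _.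
  by rewrite mulNr mulrC.
have pf2E m t : 0 <= t -> pf2 m t =
    \int[lebesgue_measure]_u (skellam_weight L L' m u * phi t u).
  move=> t0; apply: EFin_inj.
  rewrite -(@subordinated_skellam_kernel _ _ _ P _ _ L0 L'0 (D t) (phi t) (mD t t0)
    (fun w => D0 w t t0) (mphi t) (fun u => laplace t u t0)).
  rewrite /pf2 (random_time_probability mSn rSn (mD t t0))//.
  - by apply: eq_integral => w _; rewrite pE// D0.
  - by move=> w; exact: D0.
  - move=> m' t' B t'0 mB.
    have mDB : measurable (D t @^-1` B) by rewrite -[X in measurable X]setTI; exact: mD.
    have mI := measurableI _ _ (mSn t' m' t'0) mDB.
    have := hSD 1 1 (fun=> t') (fun=> t) (fun=> [set m'%:~R]) (fun=> B)
      (fun=> t'0) (fun=> t0) (fun=> measurable_set1 _) (fun=> mB).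
    have -> : [set w | forall i : 'I_1, (S t' w)%:~R \in [set m'%:~R : R]] =
        [set w | S t' w = m'].
      apply/seteqP; split => w /=; last by move=> -> _; rewrite inE.
      by move=> /(_ ord0); rewrite inE/= => /eqP; rewrite eqr_int => /eqP.
    have -> : [set w | forall j : 'I_1, D t w \in B] = D t @^-1` B.
      by apply/seteqP; split => w /=; [move=> /(_ ord0) /set_mem|move=> ? _; exact/mem_set].
    move=> e; rewrite -[LHS]fineK ?fin_num_measure// -/(prob P _) e EFinM.
    by rewrite !fineK// fin_num_measure//; exact: mSn.
apply: (frac_shifted_derivative_real (m := lebesgue_measure)
  (v := skellam_weight L L' n) (psi := psi)) => //.
  by move=> u; rewrite (lt_le_trans _ (psi0 u))// oppr_lt0 powR_gt0.
move=> t t0 e e'; have phi1t u := phi1 t u t0.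
have ie m := integrable_skellam_weight L0 L'0 m (mphi t) phi1t.
pose C := 2 * (L + L').
have r0 u := skellam_rate_ge0 L0 L'0 u; have rC u := skellam_rate_le L0 L'0 u.
have mr : measurable_fun setT (fun u => skellam_rate L L' u * phi t u).
  by apply: measurable_funM => //; exact: measurable_skellam_rate.
have ir : lebesgue_measure.-integrable setT
    (EFin \o (fun u => skellam_weight L L' n u * (skellam_rate L L' u * phi t u))).
  apply: (integrable_skellam_weight L0 L'0 n mr (C := C)) => u.
  by rewrite normrM -[C]mulr1 ler_pM// ger0_norm// rC.
have iZ : lebesgue_measure.-integrable setT
    (EFin \o (fun u => eta * (skellam_weight L L' n u * phi t u))).
  exact: (integrableZl measurableT eta (ie n)).
(* The multiplier is eta plus the rate: the first term yields eta times [pf2 n t], and the recursion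
   for the weights turns the second into the terms at n, n - 1 and n + 1. *)
have e'E : e' = (fun u => eta * (skellam_weight L L' n u * phi t u) +
    skellam_weight L L' n u * (skellam_rate L L' u * phi t u)).
  by apply/funext => u; rewrite /e' tempered_exponentK//; rewrite /phi; ring.
split; first exact: ie.
- exact: pf2E.
- by rewrite e'E; exact: (integrableD measurableT iZ ir).
- rewrite e'E RintegralD// RintegralZl//.
  by rewrite (Rintegral_skellam_weight_rec L0 L'0 n (mphi t) phi1t) !pf2E//; ring.
Qed.
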